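(* Let $\mathcal{A}\subset\mathbb{N}^n$ be a finite set all of whose elements have the same coordinate sum $d$, let $\alpha>0$, and for $z=(z_a)_{a\in\mathcal{A}}\in\mathbb{R}^{\mathcal{A}}$ put $p_z(x)=\sum_{a\in\mathcal{A}}z_a\,x_1^{a_1}\cdots x_n^{a_n}$. Suppose that, for $z$ in an open set $U\subset\mathbb{R}^{\mathcal{A}}$, the polynomial $p_z$ is hyperbolic for a fixed vector $e\in\mathbb{R}^n$, and $p_z^{-\alpha}$ is completely monotone on the hyperbolicity cone $C_z\ni e$ of $p_z$ with Riesz kernel $q(z;y)$. Then $q(z;y)$ is $\mathcal{A}$-hypergeometric as a function of the coefficients $z$: for all $u,v\in\mathbb{N}^{\mathcal{A}}$ with $\sum_{a\in\mathcal{A}}(u_a-v_a)a=0$, $$\Bigl(\prod_{a\in\mathcal{A}}\partial_a^{u_a}-\prod_{a\in\mathcal{A}}\partial_a^{v_a}\Bigr)q(z;y)=0,\qquad \partial_a=\frac{\partial}{\partial z_a},$$ wherever $q$ is sufficiently differentiable. However, $q(z;y)$ is in general not $\mathcal{A}$-homogeneous, i.e. there exist such $\mathcal{A}$, $\alpha$ and families $p_z$ for which, for no $\beta\in\mathbb{C}^n$, the function $z\mapsto q(z;y)$ is annihilated by all $n$ Euler operators $\sum_{a\in\mathcal{A}}a_iz_a\partial_a-\beta_i$, $i=1,\dots,n$.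
   Context: A homogeneous $p\in\mathbb{R}[x_1,\dots,x_n]$ is hyperbolic for $e\in\mathbb{R}^n$ if $p(e)>0$ and for every $x\in\mathbb{R}^n$ the univariate polynomial $t\mapsto p(te-x)$ has only real zeros; its hyperbolicity cone is the connected component of $\mathbb{R}^n\setminus\{p=0\}$ containing $e$, which is an open convex cone. A $\mathcal{C}^\infty$ function $f$ on an open convex cone $C$ is completely monotone if $(-1)^kD_{v_1}\cdots D_{v_k}f(x)\ge0$ for all $k\in\mathbb{N}$, $v_1,\dots,v_k\in C$, $x\in C$. With $C^*=\{y:\langle y,x\rangle\ge0\ \forall x\in C\}$, the Riesz kernel of $p^{-\alpha}$ (if it exists) is the nonnegative function $q$ on $C^*$, extended by $0$ outside $C^*$, with $p(x)^{-\alpha}=\int_{C^*}e^{-\langle y,x\rangle}q(y)\,dy$ for all $x\in C$. A sufficiently differentiable function on an open subset of $\mathbb{R}^{\mathcal{A}}$ is $\mathcal{A}$-hypergeometric if it is annihilated by all toric operators $\prod_a\partial_a^{u_a}-\prod_a\partial_a^{v_a}$ with $\sum_a(u_a-v_a)a=0$, and is $\mathcal{A}$-homogeneous of degree $\beta\in\mathbb{C}^n$ if it is also annihilated by the $n$ Euler operators $\sum_{a}a_iz_a\partial_a-\beta_i$. ''Wherever $q$ is sufficiently differentiable'' means: on any open set of pairs $(z,y)$, $z\in U$, on which $q$ is of class $\mathcal{C}^k$, where $k$ is the order of the toric operator considered. *)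

(* Defs.v *)
From HB Require Import structures.
From mathcomp Require Import all_boot all_order all_algebra.
(* Imported before, and without the notations of, MathComp-Analysis, with which
   it clashes: [multinom n] is 'X_{1..n}, [mpoly n R] is {mpoly R[n]},
   [mpolyX R a] is 'X_[a], [meval v p] is p.@[v], [ishomog1 d mdeg] is d.-homog. *)
From mathcomp Require Import -(notations) mpoly.
From mathcomp Require Import all_classical all_reals all_analysis.
From mathcomp Require Import complex.

Set Implicit Arguments.
Unset Strict Implicit.
Unset Printing Implicit Defensive.

Import Order.TTheory GRing.Theory Num.Theory.
Import numFieldNormedType.Exports.

Local Open Scope classical_set_scope.
Local Open Scope ring_scope.

Section Lebesgue.
Variable R : realType.

Definition cons_pair n (p : measurableTypeR R * n.-tuple (measurableTypeR R)) :
    n.+1.-tuple (measurableTypeR R) :=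
  [tuple of p.1 :: p.2].

(* Lebesgue measure on the Borel sets of R^n. *)
Fixpoint lebesgue_tuple (n : nat) :
    set (n.-tuple (measurableTypeR R)) -> \bar R :=
  match n with
  | 0%N => dirac [tuple]
  | n'.+1 =>
      pushforward (@lebesgue_measure R \x @lebesgue_tuple n')%E (@cons_pair n')
  end.

Lemma measurable_cons_pair n : measurable_fun setT (@cons_pair n).
Proof. exact: measurable_cons. Qed.

Lemma lebesgue_tuple_is_measure n :
  exists mu : {sigma_finite_measure set (n.-tuple (measurableTypeR R)) -> \bar R},
    (mu : set _ -> \bar R) = @lebesgue_tuple n.
Proof.
elim: n => [|n [mu muE]].
  by exists (dirac ([tuple] : 0.-tuple (measurableTypeR R))).
pose nu : {measure set
    (measurableTypeR R * n.-tuple (measurableTypeR R))%type -> \bar R} :=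
  (@lebesgue_measure R \x mu)%E.
have mc := @measurable_cons_pair n.
pose pf := measure_function_pushforward__canonical__measure_function_Measure
  nu mc.
have sf : sigma_finite setT pf.
  have /sigma_finiteP[F [TF ndF Foo]] := sigma_finiteT (@lebesgue_measure R).
  have /sigma_finiteP[G [TG ndG Goo]] := sigma_finiteT mu.
  pose g (t : n.+1.-tuple (measurableTypeR R)) :
      (measurableTypeR R * n.-tuple (measurableTypeR R))%type :=
    (thead t, [tuple of behead t]).
  have mg : measurable_fun setT g.
    apply/measurable_fun_pairP; split.
      exact: (@measurable_tnth _ (measurableTypeR R) n.+1 ord0).
    exact: measurable_behead.
  have gK : cancel (@cons_pair n) g.
    by move=> [x t]; rewrite /g /cons_pair /= theadE; congr pair; exact: val_inj.
  exists (fun k => g @^-1` (F k `*` G k)).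
    rewrite -preimage_bigcup (_ : \bigcup_i _ = setT) ?preimage_setT//.
    rewrite -subTset => -[x y] _.
    have [i _ Fix] : (\bigcup_i F i) x by rewrite -TF.
    have [j _ Gjy] : (\bigcup_i G i) y by rewrite -TG.
    exists (maxn i j) => //; split => /=.
    - by move: x Fix; exact/subsetPset/ndF/leq_maxl.
    - by move: y Gjy; exact/subsetPset/ndG/leq_maxr.
  move=> k; have [mF Fk] := Foo k; have [mG Gk] := Goo k.
  split; first by rewrite -[X in measurable X]setTI; apply: mg => //; exact: measurableX.
  rewrite /pf /= /pushforward -comp_preimage.
  rewrite (_ : g \o _ = id) ?preimage_id; last by apply/funext => p; exact: gK.
  by rewrite /nu /= product_measure1E// lte_mul_pinfty// ge0_fin_numE.
pose H := Measure_isSigmaFinite.Build _ _ _ (pf : set _ -> \bar R) sf.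
pose pf' : {sigma_finite_measure set (n.+1.-tuple (measurableTypeR R)) -> \bar R} :=
  HB.pack (Measure.sort pf) H.
by exists pf'; rewrite /= -muE.
Qed.

Section lebesgue_tuple_instances.
Variable n : nat.
Notation leb := (@lebesgue_tuple n).

Let leb0 : leb set0 = 0%E.
Proof. by have [mu <-] := lebesgue_tuple_is_measure n. Qed.

Let leb_ge0 A : (0 <= leb A)%E.
Proof. by have [mu <-] := lebesgue_tuple_is_measure n. Qed.

Let leb_semi_sigma_additive : semi_sigma_additive leb.
Proof.
have [mu <-] := lebesgue_tuple_is_measure n.
exact: measure_semi_sigma_additive.
Qed.

HB.instance Definition _ := isMeasure.Build _ _ _ leb
  leb0 leb_ge0 leb_semi_sigma_additive.

Let leb_sigma_finite : sigma_finite setT leb.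
Proof. have [mu <-] := lebesgue_tuple_is_measure n; exact: sigma_finiteT. Qed.

HB.instance Definition _ := Measure_isSigmaFinite.Build _ _ _ leb
  leb_sigma_finite.

End lebesgue_tuple_instances.

Definition row_of_tuple n (t : n.-tuple (measurableTypeR R)) : 'rV[R]_n :=
  \row_i tnth t i.

(* Measurability with respect to the completed measure, i.e. almost everywhere
   equality with a Borel function. *)
Definition lebesgue_measurable n (f : 'rV[R]_n -> R) : Prop :=
  exists2 g : n.-tuple (measurableTypeR R) -> R, measurable_fun setT g &
    {ae @lebesgue_tuple n, forall t, f (row_of_tuple t) = g t}.

(* For f >= 0 the library integral is the supremum of the integrals of the Borel
   simple functions below f; it is the Lebesgue integral for every f that is
   measurable in the sense of [lebesgue_measurable]. *)
Definition lebesgue_int n (D : set 'rV[R]_n) (f : 'rV[R]_n -> R) : \bar R :=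
  (\int[@lebesgue_tuple n]_(t in @row_of_tuple n @^-1` D)
     (f (row_of_tuple t))%:E)%E.

End Lebesgue.

Section Differentiability.
Variables (R : realType) (V : normedModType R).

(* Class C^k on an open set W; in finite dimension, asking for the derivatives in
   all directions or only along a basis makes no difference. *)
Fixpoint class_C (k : nat) (W : set V) (f : V -> R) : Prop :=
  (forall x, W x -> {for x, continuous f}) /\
  match k with
  | 0%N => True
  | k'.+1 => forall v : V,
      (forall x, W x -> derivable f x v) /\ class_C k' W ('D_v f)
  end.

Definition smooth (W : set V) (f : V -> R) : Prop := forall k, class_C k W f.

Definition completely_monotone (C : set V) (f : V -> R) : Prop :=
  smooth C f /\
  forall (vs : seq V) (x : V), (forall v, v \in vs -> C v) -> C x ->
    0 <= (-1) ^+ size vs * foldr (fun v g => 'D_v g) f vs x.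

End Differentiability.

Section Hyperbolic.
Variables (R : realType) (n : nat).
Implicit Types (p : mpoly n R) (e x y : 'rV[R]_n) (C : set 'rV[R]_n).

Definition dotrow y x : R := \sum_i y 0 i * x 0 i.

Definition mpoly_eval p x : R := meval (fun i => x 0 i) p.

(* The univariate polynomial t |-> p(t e - x). *)
Definition line_restriction p e x : {poly R} :=
  mmap (@polyC R) (fun i => e 0 i *: 'X - (x 0 i)%:P) p.

Definition hyperbolic p e : Prop :=
  [/\ exists d, p \is ishomog1 d mdeg,
      0 < mpoly_eval p e &
      forall x (w : R[i]),
        root (map_poly (real_complex R) (line_restriction p e x)) w ->
        complex.Im w = 0].

Definition hyperbolicity_cone p e : set 'rV[R]_n :=
  connected_component [set x | mpoly_eval p x != 0] e.

Definition dual_cone C : set 'rV[R]_n :=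
  [set y | forall x, C x -> 0 <= dotrow y x].

Definition neg_power p (alpha : R) : 'rV[R]_n -> R :=
  fun x => mpoly_eval p x `^ (- alpha).

Definition is_riesz_kernel p (alpha : R) C (q : 'rV[R]_n -> R) : Prop :=
  [/\ forall y, 0 <= q y,
      forall y, ~ dual_cone C y -> q y = 0,
      lebesgue_measurable q &
      forall x, C x ->
        lebesgue_int (dual_cone C) (fun y => expR (- dotrow y x) * q y) =
        (neg_power p alpha x)%:E].

End Hyperbolic.

(* The finite set A of exponents is given by a duplicate-free enumeration, so that
   R^A becomes 'rV[R]_m and N^A becomes [multinom m], with m the cardinal of A. *)
Section Hypergeometric.
Variables (R : realType) (n m : nat) (A : m.-tuple (multinom n)).
Implicit Types (u v : multinom m) (f : 'rV[R]_m -> R) (z : 'rV[R]_m).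

Definition poly_of_coefs z : mpoly n R :=
  \sum_(j < m) z 0 j *: mpolyX R (tnth A j).

(* The composition of the 'D_('e_j)^(u_j), j < m. *)
Definition partials u f : 'rV[R]_m -> R :=
  foldr (fun j => iter (u j) (fun g => 'D_(delta_mx 0 j) g)) f (enum 'I_m).

Definition toric_operator u v f : 'rV[R]_m -> R :=
  fun z => partials u f z - partials v f z.

Definition toric_relation u v : Prop :=
  forall i : 'I_n, \sum_(j < m) ((u j)%:Z - (v j)%:Z) * (tnth A j i)%:Z = 0.

Definition euler_operator (i : 'I_n) (b : R[i]) f : 'rV[R]_m -> R[i] :=
  fun z =>
    real_complex R
      (\sum_(j < m) (tnth A j i)%:R * z 0 j * 'D_(delta_mx 0 j) f z)
    - b * real_complex R (f z).

Definition A_homogeneous (beta : 'rV[R[i]]_n) (D : set 'rV[R]_m) f : Prop :=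
  forall (i : 'I_n) z, D z -> euler_operator i (beta 0 i) f z = 0.

(* A is a set of exponents of degree d in n >= 1 variables and, for z in the open
   set U, p_z is hyperbolic for e and q z is the Riesz kernel of its completely
   monotone power p_z^(- alpha). *)
Definition riesz_family (d : nat) (alpha : R) (e : 'rV[R]_n)
    (U : set 'rV[R]_m) (q : 'rV[R]_m -> 'rV[R]_n -> R) : Prop :=
  [/\ (0 < n)%N,
      uniq A /\ (forall a, a \in tval A -> mdeg a = d),
      0 < alpha,
      open U &
      forall z, U z ->
        let p := poly_of_coefs z in
        let C := hyperbolicity_cone p e in
        [/\ hyperbolic p e,
            completely_monotone C (neg_power p alpha) &
            is_riesz_kernel p alpha C (q z)]].

End Hypergeometric.

(* Main.v *)
Require Import Defs.
From mathcomp Require Import all_boot all_order all_algebra.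
From mathcomp Require Import -(notations) mpoly.
From mathcomp Require Import all_classical all_reals all_analysis.
From mathcomp Require Import complex measurable_realfun ring lra.

Set Implicit Arguments.
Unset Strict Implicit.
Unset Printing Implicit Defensive.

Import Order.TTheory GRing.Theory Num.Theory.
Import numFieldNormedType.Exports.

Local Open Scope classical_set_scope.
Local Open Scope ring_scope.

(** For a fixed [x], the Laplace transform p_z(x)^(- alpha) of the kernel is a
    power of the linear form z |-> sum_a z_a x^a. Its derivative of multi-index
    [u] in [z] only depends on [u] through |u| and the monomial
    x^(sum_a u_a a), so it is the same for [u] and [v] when they satisfy a toric
    relation. The work lies in transporting this from the Laplace transform to
    the kernel [q] at one point [(z0, y0)], although [q] is only differentiable
    near that point, is elsewhere only determined up to null sets, and lives on
    a cone that moves with [z].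

    Derivatives in [z] are therefore replaced by finite differences, which
    commute with the integral over [y] whatever the regularity of [q].
    Averaging the difference quotients of step h / N over suitable translates
    gives a finite combination of values of the function, whose total mass is
    bounded independently of N ([averaging_functional]); this replaces an
    integration by parts against a bump function. By the mean value theorem
    ([fdiffs_mvt]) the quotients of [q] approach the toric operator near
    [(z0, y0)] ([fdiff2_lower]), while those of a power of a linear form satisfy
    the toric equation in the limit ([flat_ridge]).

    Localization at [y0] uses finite combinations of the exponentials
    exp(- <y, x>), [x] in a cone contained in every C_z for [z] near [z0].
    Integrated against the kernels they give combinations of powers of linear
    forms in [z] ([exp_comb_laplace]), and one of them, [peak], has values in
    [0, 1] on the dual of that cone and stays away from its maximum 1 outside
    any ball around [y0] ([peak_outside]). If the toric operator were
    positive at [(z0, y0)], the averaged difference quotients of the integrals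
    of [peak ^+ M] would be at least a constant times theta2 ^ M, up to an error
    of order theta1 ^ M with theta1 < theta2 due to the [y] far from [y0]; but
    they tend to 0 with the step, which is absurd for M large
    ([peak_contradiction]). Exchanging [u] and [v] gives the equality.

    For the failure of homogeneity, take p_z(x) = x_1 (z_1 x_1 + z_2 x_2) and
    alpha = 2. The kernel is y_2 (z_2 y_1 - z_1 y_2) / z_2^3 on the dual cone
    ([quad_kernel_laplace]). Its two terms have the degrees -2 and -3 in z_2, so
    the Euler operator z_2 d/dz_2 does not act on it by a scalar
    ([quad_kernel_not_homogeneous]). *)

(** * Finite differences and averages of their quotients *)

Section FiniteDifferences.
Variables (R : realType) (V : normedModType R).
Implicit Types (h : R) (v x : V) (vs us : seq V) (f g : V -> R).

Definition fdiff h v f : V -> R := fun x => f (x + h *: v) - f x.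
Definition ftrans_sum (N : nat) h v f : V -> R :=
  fun x => \sum_(r < N) f (x + (h *+ r) *: v).

Definition fdiffs h vs f := foldr (fdiff h) f vs.
Definition ftrans_sums N h vs f := foldr (ftrans_sum N h) f vs.

Lemma ftrans_sum_fdiff N h v f :
  ftrans_sum N h v (fdiff h v f) = fdiff (h *+ N) v f.
Proof.
apply/funext => x; rewrite /ftrans_sum /fdiff.
under eq_bigr => r _ do rewrite -addrA -scalerDl -mulrSr.
rewrite -(big_mkord xpredT (fun r => f (x + (h *+ r.+1) *: v) - f (x + (h *+ r) *: v))).
by rewrite telescope_sumr// mulr0n scale0r addr0.
Qed.

Lemma ftrans_sum_fdiffC N h h' v w f :
  ftrans_sum N h v (fdiff h' w f) = fdiff h' w (ftrans_sum N h v f).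
Proof.
apply/funext => x; rewrite /ftrans_sum /fdiff -sumrB.
by under eq_bigr => r _ do rewrite addrAC.
Qed.

Lemma ftrans_sumC N h v w f :
  ftrans_sum N h v (ftrans_sum N h w f) = ftrans_sum N h w (ftrans_sum N h v f).
Proof.
apply/funext => x; rewrite /ftrans_sum exchange_big /=.
by do 2 (apply: eq_bigr => ? _); rewrite addrAC.
Qed.

Lemma ftrans_sums_fdiffC N h h' vs w f :
  ftrans_sums N h vs (fdiff h' w f) = fdiff h' w (ftrans_sums N h vs f).
Proof. by elim: vs => //= v vs ->; rewrite ftrans_sum_fdiffC. Qed.

Lemma ftrans_sums_cat N h us vs f :
  ftrans_sums N h us (ftrans_sums N h vs f) = ftrans_sums N h (us ++ vs) f.
Proof. by rewrite /ftrans_sums foldr_cat. Qed.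

Lemma ftrans_sumsC N h us vs f :
  ftrans_sums N h us (ftrans_sums N h vs f) =
  ftrans_sums N h vs (ftrans_sums N h us f).
Proof.
elim: us => //= u us ->; elim: vs => //= v vs <-.
by rewrite ftrans_sumC.
Qed.

(** Telescoping: differences of step [h], summed over [N] consecutive translates
    in the same directions, become differences of step [h *+ N]. *)
Lemma ftrans_sums_fdiffs N h vs f :
  ftrans_sums N h vs (fdiffs h vs f) = fdiffs (h *+ N) vs f.
Proof.
elim: vs => //= v vs <-.
by rewrite ftrans_sums_fdiffC ftrans_sum_fdiff.
Qed.

Lemma fdiffsD h vs f g :
  fdiffs h vs (fun x => f x + g x) = fun x => fdiffs h vs f x + fdiffs h vs g x.
Proof.
by elim: vs => //= v vs ->; apply/funext => x; rewrite /fdiff opprD addrACA.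
Qed.

Lemma fdiffsZ h vs c f :
  fdiffs h vs (fun x => c * f x) = fun x => c * fdiffs h vs f x.
Proof.
by elim: vs => //= v vs ->; apply/funext => x; rewrite /fdiff mulrBr.
Qed.

Lemma ftrans_sumsB N h vs f g :
  ftrans_sums N h vs (fun x => f x - g x) =
  fun x => ftrans_sums N h vs f x - ftrans_sums N h vs g x.
Proof.
by elim: vs => //= v vs ->; apply/funext => x; rewrite /ftrans_sum sumrB.
Qed.

Lemma step_norm h v : 0 <= h -> `|v| <= 1 -> `|h *: v| <= h.
Proof. by move=> h0 v1; rewrite normrZ ger0_norm// ler_piMr. Qed.

Lemma eq_fdiffs h vs f g x : 0 <= h -> {in vs, forall v, `|v| <= 1} ->
  (forall y, `|y - x| <= h * (size vs)%:R -> f y = g y) ->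
  fdiffs h vs f x = fdiffs h vs g x.
Proof.
move=> h0; elim: vs x => [|v vs IH] x v1 fg /=.
  by apply: fg; rewrite subrr normr0 mulr0.
have v1' : `|v| <= 1 by apply: v1; rewrite mem_head.
have vs1 : {in vs, forall v, `|v| <= 1}.
  by move=> w wvs; apply: v1; rewrite inE wvs orbT.
rewrite /fdiff; congr (_ - _); apply: IH => // y yx; apply: fg.
  have -> : y - x = (y - (x + h *: v)) + h *: v by rewrite opprD addrA subrK.
  rewrite (le_trans (ler_normD _ _))//= -natr1 mulrDr mulr1.
  by rewrite lerD// step_norm.
by rewrite (le_trans yx)// ler_wpM2l//= ler_nat.
Qed.

Lemma le_ftrans_sums N h vs f x (a : R) : 0 <= h ->
  {in vs, forall v, `|v| <= 1} ->
  (forall y, `|y - x| <= h * N%:R * (size vs)%:R -> a <= f y) ->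
  a * (N%:R ^+ size vs) <= ftrans_sums N h vs f x.
Proof.
move=> h0; elim: vs x => [|v vs IH] x v1 fg /=.
  by rewrite expr0 mulr1; apply: fg; rewrite subrr normr0 mulr0.
have v1' : `|v| <= 1 by apply: v1; rewrite mem_head.
have vs1 : {in vs, forall v, `|v| <= 1}.
  by move=> w wvs; apply: v1; rewrite inE wvs orbT.
rewrite /ftrans_sum exprS mulrCA mulr_natl -[in X in _ *+ X](card_ord N) -sumr_const.
apply: ler_sum => r _; apply: IH => // y yx; apply: fg.
have -> : y - x = (y - (x + (h *+ r) *: v)) + (h *+ r) *: v.
  by rewrite opprD addrA subrK.
rewrite (le_trans (ler_normD _ _))//= -natr1 mulrDr mulr1.
rewrite lerD//; apply: (le_trans (step_norm _ v1')); first exact: mulrn_wge0.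
by rewrite -[leLHS]mulr_natr ler_wpM2l// ler_nat ltnW.
Qed.

Definition wsum (l : seq (R * V)) f : R := \sum_(p <- l) p.1 * f p.2.

(** [T] is integration against a signed measure with finite support, of total
    variation at most [B], carried by the ball of radius [rho] around [x]. *)
Definition finite_functional (B rho : R) x (T : (V -> R) -> R) : Prop :=
  exists l : seq (R * V), [/\ forall f, T f = wsum l f,
    \sum_(p <- l) `|p.1| <= B & forall p, p \in l -> `|p.2 - x| <= rho].

Lemma finite_functional_eval x : finite_functional 1 0 x (fun f => f x).
Proof.
exists [:: (1, x)]; split=> [f||p].
- by rewrite /wsum big_seq1 mul1r.
- by rewrite big_seq1 normr1.
- by rewrite inE => /eqP->/=; rewrite subrr normr0.
Qed.

Lemma finite_functionalZ c B rho x T :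
  finite_functional B rho x T -> finite_functional (`|c| * B) rho x (fun f => c * T f).
Proof.
move=> [l [lT lB lrho]]; exists [seq (c * p.1, p.2) | p <- l]; split=> [f||p].
- by rewrite lT /wsum big_map mulr_sumr; apply: eq_bigr => i _ /=; rewrite mulrA.
- rewrite big_map; under eq_bigr do rewrite normrM.
  by rewrite -mulr_sumr ler_wpM2l.
- by move=> /mapP[q /lrho + ->].
Qed.

Lemma finite_functionalD B1 B2 rho x T1 T2 :
  finite_functional B1 rho x T1 -> finite_functional B2 rho x T2 ->
  finite_functional (B1 + B2) rho x (fun f => T1 f + T2 f).
Proof.
move=> [l [lT lB lrho]] [l' [lT' lB' lrho']]; exists (l ++ l'); split=> [f||p].
- by rewrite lT lT' /wsum big_cat.
- by rewrite big_cat lerD.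
- by rewrite mem_cat => /orP[/lrho|/lrho'].
Qed.

Lemma finite_functionalB B1 B2 rho x T1 T2 :
  finite_functional B1 rho x T1 -> finite_functional B2 rho x T2 ->
  finite_functional (B1 + B2) rho x (fun f => T1 f - T2 f).
Proof.
move=> T1P /(finite_functionalZ (-1)); rewrite normrN1 mul1r => T2P.
have [l [lT lB lrho]] := finite_functionalD T1P T2P.
by exists l; split => // f; rewrite -lT mulN1r.
Qed.

Lemma finite_functional_move B rho rho' x x' T :
  finite_functional B rho x' T -> `|x' - x| + rho <= rho' ->
  finite_functional B rho' x T.
Proof.
move=> [l [lT lB lrho]] xx'; exists l; split => // p /lrho prho.
rewrite (le_trans _ xx')// -[p.2](subrK x') -addrA [leRHS]addrC.
by rewrite (le_trans (ler_normD _ _))// lerD2r.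
Qed.

Lemma finite_functional_fdiffs h vs B rho x (T : (V -> R) -> V -> R) :
  0 <= h -> {in vs, forall v, `|v| <= 1} ->
  (forall y, finite_functional B rho y (fun f => T f y)) ->
  finite_functional (2 ^+ size vs * B) (h * (size vs)%:R + rho) x
    (fun f => fdiffs h vs (T f) x).
Proof.
move=> h0 + Tx; elim: vs x => [|v vs IH] x v1 /=.
  by rewrite expr0 mul1r mulr0 add0r.
have v1' : `|v| <= 1 by apply: v1; rewrite mem_head.
have {}IH y := IH y (fun w wvs => v1 w (mem_behead (wvs : w \in behead (v :: vs)))).
rewrite exprS -mulrA mulr_natl mulr2n.
apply: finite_functionalB; apply: finite_functional_move (IH _) _.
  rewrite addrAC subrr add0r -natr1 mulrDr mulr1.
  by have := step_norm h0 v1'; lra.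
by rewrite subrr normr0 add0r lerD2r ler_wpM2l// ler_nat.
Qed.

Lemma finite_functional_sum N B rho x (T : 'I_N -> (V -> R) -> R) :
  0 <= B ->
  (forall i, finite_functional B rho x (T i)) ->
  finite_functional (N%:R * B) rho x (fun f => \sum_(i < N) T i f).
Proof.
move=> B0 /(_ _)/cid-/all_sig[l lP]; exists (flatten [seq l i | i <- enum 'I_N]).
split=> [f||p].
- rewrite /wsum big_flatten/= big_map big_enum/=; apply: eq_bigr => i _.
  by have [-> _ _] := lP i.
- rewrite big_flatten/= big_map big_enum/= mulr_natl -[in X in _ *+ X](card_ord N).
  by rewrite -sumr_const; apply: ler_sum => i _; have [] := lP i.
- by move=> /flattenP[s /mapP[i _ ->]]; have [_ _] := lP i; apply.
Qed.

Lemma finite_functional_ftrans_sums N h vs B rho x (T : (V -> R) -> V -> R) :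
  0 <= h -> 0 <= B -> {in vs, forall v, `|v| <= 1} ->
  (forall y, finite_functional B rho y (fun f => T f y)) ->
  finite_functional (N%:R ^+ size vs * B) (h * N%:R * (size vs)%:R + rho) x
    (fun f => ftrans_sums N h vs (T f) x).
Proof.
move=> h0 B0 + Tx; elim: vs x => [|v vs IH] x v1 /=.
  by rewrite expr0 mul1r mulr0 add0r.
have v1' : `|v| <= 1 by apply: v1; rewrite mem_head.
have {}IH y := IH y (fun w wvs => v1 w (mem_behead (wvs : w \in behead (v :: vs)))).
rewrite exprS -mulrA.
apply: (@finite_functional_sum _ _ _ _ (fun (r : 'I_N) f => ftrans_sums N h vs (T f) (x + (h *+ r) *: v))) => [|r].
  by rewrite mulr_ge0// exprn_ge0.
apply: finite_functional_move (IH _) _.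
rewrite addrAC subrr add0r -natr1 mulrDr mulr1.
have : `|(h *+ r) *: v| <= h * N%:R.
  apply: (le_trans (step_norm _ v1')); first exact: mulrn_wge0.
  by rewrite -[leLHS]mulr_natr ler_wpM2l// ler_nat ltnW.
by lra.
Qed.

Definition fdiff2 h us vs f x := fdiffs h us f x - fdiffs h vs f x.

(** A discrete substitute for an integration by parts against a bump function.
    Averaging the difference quotients along [us], of step [h / N], over
    translates in the directions [us] and [vs] turns them by telescoping into
    quotients of the fixed step [h] averaged along [vs] only; likewise with
    [us] and [vs] exchanged. The result is thus a mean of [fdiff2] at the small
    step, and has a total mass that does not depend on [N]. *)
Lemma averaging_functional k us vs h N x : size us = k -> size vs = k ->
  {in us, forall v, `|v| <= 1} -> {in vs, forall v, `|v| <= 1} ->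
  0 < h -> (0 < N)%N ->
  exists l : seq (R * V), [/\
    forall p, p \in l -> `|p.2 - x| <= h * (2 * k)%:R,
    \sum_(p <- l) `|p.1| <= 2 ^+ k.+1 / h ^+ k &
    forall f a, (forall y, `|y - x| <= h * (2 * k)%:R ->
        a * (h / N%:R) ^+ k <= fdiff2 (h / N%:R) us vs f y) ->
      a <= wsum l f].
Proof.
move=> uk vk u1 v1 h0 N0.
have N0' : 0 < N%:R :> R by rewrite ltr0n.
have hN0 : 0 <= h / N%:R by rewrite divr_ge0// ltW.
have hNN : h / N%:R * N%:R = h by rewrite divfK// gt_eqF.
(* There are [N ^ (2 * k)] translates, and [N ^ (2 * k) * (h / N) ^ k = (h * N) ^ k]. *)
pose c : R := ((h * N%:R) ^+ k)^-1.
have ff1 us' vs' : size us' = k -> size vs' = k ->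
    {in us', forall v, `|v| <= 1} -> {in vs', forall v, `|v| <= 1} ->
    finite_functional (N%:R ^+ k * 2 ^+ k) (h * (2 * k)%:R) x
    (fun f => ftrans_sums N (h / N%:R) us' (fdiffs h vs' f) x).
  move=> uk' vk' u1' v1'.
  have := @finite_functional_ftrans_sums N (h / N%:R) us' (2 ^+ k) (h * k%:R) x
    (fun f => fdiffs h vs' f) hN0 (exprn_ge0 _ (ler0n _ _)) u1'.
  rewrite hNN uk' -mulrDr -natrD addnn -mul2n; apply => y.
  have := @finite_functional_fdiffs h vs' 1 0 y (fun f => f) (ltW h0) v1' finite_functional_eval.
  by rewrite mulr1 addr0 vk'.
have := finite_functionalZ c (finite_functionalB (ff1 vs us vk uk v1 u1) (ff1 us vs uk vk u1 v1)).
move=> [l [lE lB lr]]; exists l; split => //.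
  apply: (le_trans lB); rewrite ger0_norm; last first.
    by rewrite invr_ge0 exprn_ge0// mulr_ge0// ltW.
  by rewrite /c exprMn exprS le_eqVlt; apply/orP; left; apply/eqP; field; rewrite !expf_neq0 ?gt_eqF.
move=> f a fa; rewrite -lE.
have E us' vs' : ftrans_sums N (h / N%:R) us' (fdiffs h vs' f) =
    ftrans_sums N (h / N%:R) (us' ++ vs') (fdiffs (h / N%:R) vs' f).
  by rewrite -ftrans_sums_cat ftrans_sums_fdiffs (_ : (h / N%:R) *+ N = h) ?ftrans_sums_cat// -mulr_natr hNN.
rewrite !E -[X in _ - X]/(ftrans_sums _ _ _ _ _) -ftrans_sums_cat ftrans_sumsC ftrans_sums_cat.
rewrite -[X in c * X]/((fun x => _ x - _ x) x) -ftrans_sumsB.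
have := @le_ftrans_sums N (h / N%:R) (us ++ vs)
   (fun y => fdiffs (h / N%:R) us f y - fdiffs (h / N%:R) vs f y) x
   (a * (h / N%:R) ^+ k) hN0.
rewrite hNN size_cat uk vk addnn -mul2n => /(_ _ fa) H.
rewrite /c mulrC ler_pdivlMr ?exprn_gt0 ?mulr_gt0//.
apply: le_trans (H _); last by move=> w; rewrite mem_cat => /orP[/u1|/v1].
rewrite mul2n -addnn exprD -mulrA [X in _ <= _ * X]mulrA -!exprMn divfK ?lexx//.
by rewrite gt_eqF.
Qed.
End FiniteDifferences.

(** * Finite differences and iterated derivatives *)

Section DifferencesAndDerivatives.
Variables (R : realType) (V : normedModType R).
Implicit Types (h : R) (v x : V) (vs us : seq V) (f g : V -> R).

Lemma is_derive_translate f (a x w : V) (d : R) :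
  is_derive (x + a) w f d -> is_derive x w (fun y => f (y + a)) d.
Proof.
move=> [df <-].
have E : (fun h : R => h^-1 *: ((((fun y => f (y + a)) \o shift x) (h *: w)) - f (x + a)))
  = (fun h : R => h^-1 *: (((f \o shift (x + a)) (h *: w)) - f (x + a))).
  by apply/funext => h /=; rewrite addrA.
by split; [rewrite /derivable E | rewrite /derive E].
Qed.

Lemma is_derive_line f (x v : V) (t d : R) :
  is_derive (x + t *: v) v f d -> is_derive t 1 (fun s => f (x + s *: v)) d.
Proof.
move=> [df <-].
have E : (fun h : R => h^-1 *: ((((fun s => f (x + s *: v)) \o shift t) (h *: 1)) - f (x + t *: v)))
  = (fun h : R => h^-1 *: (((f \o shift (x + t *: v)) (h *: v)) - f (x + t *: v))).
  by apply/funext => h /=; rewrite [h *: 1]mulr1 scalerDl addrCA.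
by split; [rewrite /derivable E | rewrite /derive E].
Qed.

Lemma is_derive_fdiffs h vs f f1 x w : 0 <= h -> {in vs, forall v, `|v| <= 1} ->
  (forall y, `|y - x| <= h * (size vs)%:R -> is_derive y w f (f1 y)) ->
  is_derive x w (fdiffs h vs f) (fdiffs h vs f1 x).
Proof.
move=> h0; elim: vs x => [|v vs IH] x v1 ff1 /=.
  by apply: ff1; rewrite subrr normr0 mulr0.
have v1' : `|v| <= 1 by apply: v1; rewrite mem_head.
have vs1 : {in vs, forall v, `|v| <= 1}.
  by move=> u uvs; apply: v1; rewrite inE uvs orbT.
apply: is_deriveB; last first.
  by apply: IH => // y yx; apply: ff1; rewrite (le_trans yx)// ler_wpM2l//= ler_nat.
apply: (is_derive_translate (f := fdiffs h vs f)).
apply: IH => // y yx; apply: ff1.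
have -> : y - x = (y - (x + h *: v)) + h *: v by rewrite opprD addrA subrK.
rewrite (le_trans (ler_normD _ _))//= -natr1 mulrDr mulr1.
by rewrite lerD// step_norm.
Qed.

(** A relation rather than an iterated derivative, so that the intermediate
    derivatives may be given by formulas that are valid on [O] only. *)
Fixpoint derive_chain (O : set V) vs f g : Prop :=
  if vs is v :: vs' then
    exists2 f1, (forall x, O x -> is_derive x v f (f1 x)) & derive_chain O vs' f1 g
  else f = g.

(** The first difference is differentiated and the mean value theorem applied to
    it along its direction; since differences commute with differentiation, the
    other differences are then those of the first derivative. *)
Lemma fdiffs_mvt h vs f g x0 r x : 0 < h -> {in vs, forall v, `|v| <= 1} ->
  derive_chain [set y | `|y - x0| < r] vs f g ->
  `|x - x0| + h * (size vs)%:R < r ->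
  exists2 y, `|y - x| <= h * (size vs)%:R & fdiffs h vs f x = h ^+ size vs * g y.
Proof.
move=> h0; elim: vs f x => [|v vs IH] f x v1 /=.
  by move=> -> _; exists x; rewrite ?subrr ?normr0 ?mulr0// expr0 mul1r.
have v1' : `|v| <= 1 by apply: v1; rewrite mem_head.
have vs1 : {in vs, forall v, `|v| <= 1}.
  by move=> u uvs; apply: v1; rewrite inE uvs orbT.
move=> [f1 ff1 f1g] xr.
have tv (t : R) : 0 <= t -> t <= h -> `|t *: v| <= h.
  by move=> t0 th; rewrite (le_trans (step_norm t0 v1')).
have nearx (t : R) : 0 <= t -> t <= h -> `|x + t *: v - x0| + h * (size vs)%:R < r.
  move=> t0 th; apply: le_lt_trans xr; rewrite -natr1 mulrDr mulr1.
  have -> : x + t *: v - x0 = (x - x0) + t *: v by rewrite addrAC.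
  have := ler_normD (x - x0) (t *: v); have := tv t t0 th; lra.
pose phi t := fdiffs h vs f (x + t *: v).
have dphi (t : R) : 0 <= t -> t <= h ->
    is_derive t 1 phi (fdiffs h vs f1 (x + t *: v)).
  move=> t0 th; apply: is_derive_line; apply: is_derive_fdiffs => //; first exact: ltW.
  move=> y yx; apply: ff1 => /=; apply: le_lt_trans (nearx t t0 th).
  have -> : y - x0 = (x + t *: v - x0) + (y - (x + t *: v)).
    by rewrite [RHS]addrC addrA subrK.
  by rewrite (le_trans (ler_normD _ _))// lerD2l.
have cphi : {within `[0, h], continuous phi}.
  apply: derivable_within_continuous => t; rewrite in_itv/= => /andP[t0 th].
  by have [] := dphi t t0 th.
have dphi' t : t \in `]0, h[ -> is_derive t 1 phi (fdiffs h vs f1 (x + t *: v)).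
  by rewrite in_itv/= => /andP[t0 th]; apply: dphi; exact: ltW.
have [t] := MVT h0 dphi' cphi.
rewrite in_itv/= => /andP[t0 th]; rewrite /phi scale0r addr0 subr0 => E.
have [y yx yE] := IH f1 (x + t *: v) vs1 f1g (nearx t (ltW t0) (ltW th)).
exists y.
  rewrite -natr1 mulrDr mulr1.
  have -> : y - x = (y - (x + t *: v)) + t *: v by rewrite opprD addrA subrK.
  by rewrite (le_trans (ler_normD _ _))// lerD// tv// ltW.
by rewrite [LHS]E yE mulrC mulrA -exprS.
Qed.
End DifferencesAndDerivatives.

Section SectionDerivatives.
Variable R : realType.

Lemma class_CW (V : normedModType R) k (W : set V) f : class_C k.+1 W f -> class_C k W f.
Proof.
elim: k f => [|k IH] f; first by move=> [cf _]; split.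
by move=> [cf df]; split=> // v; have [dv Cv] := df v; split => //; exact: IH.
Qed.

Lemma le_class_C (V : normedModType R) k l (W : set V) f : (k <= l)%N ->
  class_C l W f -> class_C k W f.
Proof.
move=> /subnK <-; elim: (l - k)%N => //= d IH /class_CW; exact: IH.
Qed.

Definition iterD (V : normedModType R) (vs : seq V) (f : V -> R) :=
  foldl (fun g v => 'D_v g) f vs.

Lemma class_C_iterD (V : normedModType R) vs k (W : set V) f :
  class_C (size vs + k) W f -> class_C k W (iterD vs f).
Proof. by elim: vs f => //= v vs IH f [_ df]; have [_ ] := df v; exact: IH. Qed.

Lemma class_C_derive_chain (V : normedModType R) vs (W : set V) f :
  class_C (size vs) W f -> derive_chain W vs f (iterD vs f).
Proof.
elim: vs f => //= v vs IH f [_ df]; have [dv Cv] := df v.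
by exists ('D_v f); [move=> x Wx; exact/derivableP/dv | exact: IH].
Qed.

Lemma sub_derive_chain (V : normedModType R) vs (O O' : set V) f g :
  O `<=` O' -> derive_chain O' vs f g -> derive_chain O vs f g.
Proof.
move=> OO'; elim: vs f => //= v vs IH f [f1 df f1g].
by exists f1; [move=> x /OO'; exact: df | exact: IH].
Qed.

Variables (V Y : normedModType R).
Implicit Types (F : V * Y -> R).

Lemma growth_section F v z y :
  (fun h : R => h^-1 *: ((F \o shift (z, y)) (h *: (v, 0)) - F (z, y))) =
  (fun h : R => h^-1 *: (((fun z' => F (z', y)) \o shift z) (h *: v) - F (z, y))).
Proof.
apply/funext => h /=; congr (_ *: (F _ - _)).
by apply/pair_equal_spec; split => //=; rewrite scaler0 add0r.
Qed.

(** The two difference quotients are the same function, so this needs no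
    differentiability. *)
Lemma derive_section F v z y :
  'D_(v, 0) F (z, y) = 'D_v (fun z' => F (z', y)) z.
Proof. by rewrite /derive growth_section. Qed.

Lemma is_derive_section F v z y d :
  is_derive (z, y) (v, 0) F d -> is_derive z v (fun z' => F (z', y)) d.
Proof.
move=> [df <-]; split; last by rewrite derive_section.
by move: df; rewrite /derivable growth_section.
Qed.

Lemma derive_chain_section (W : set (V * Y)) vs F G y :
  derive_chain W [seq (v, 0) | v <- vs] F G ->
  derive_chain [set z | W (z, y)] vs (fun z => F (z, y)) (fun z => G (z, y)).
Proof.
elim: vs F => [|v vs IH] F /=; first by move=> ->.
move=> [F1 dF F1G]; exists (fun z => F1 (z, y)); last exact: IH.
by move=> z Wz; exact/is_derive_section/dF.
Qed.

Lemma iterD_section vs F z y :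
  iterD [seq (v, 0) | v <- vs] F (z, y) = iterD vs (fun z' => F (z', y)) z.
Proof.
rewrite /iterD; elim: vs F => //= v vs IH F; rewrite IH; congr (foldl _ _ vs z).
by apply/funext => z'; rewrite derive_section.
Qed.
End SectionDerivatives.

(** * Asymptotic solutions of a toric equation *)

Section FlatFunctions.
Variables (R : realType) (V : normedModType R).
Implicit Types (h : R) (v x : V) (vs us : seq V) (f g : V -> R).

(** The toric equation in the limit of small steps. Unlike the differential
    equation, it makes sense for functions of [x] about which nothing is known
    but their values, such as integrals of kernels. *)
Definition flat us vs (k : nat) x0 (rho : R) f : Prop :=
  forall eps : R, 0 < eps -> exists2 h0 : R, 0 < h0 & forall h, 0 < h -> h < h0 ->
    forall x, `|x - x0| <= rho -> `|fdiff2 h us vs f x| <= eps * h ^+ k.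

Lemma flatD us vs k x0 rho f g : flat us vs k x0 rho f -> flat us vs k x0 rho g ->
  flat us vs k x0 rho (fun x => f x + g x).
Proof.
move=> ff fg eps e0; have e20 : 0 < eps / 2 by rewrite divr_gt0.
have [h1 h10 H1] := ff _ e20; have [h2 h20 H2] := fg _ e20.
exists (Num.min h1 h2); first by rewrite lt_min h10.
move=> h hgt0; rewrite lt_min => /andP[hh1 hh2] x xr.
rewrite /fdiff2 !fdiffsD opprD addrACA (le_trans (ler_normD _ _))//.
by rewrite [eps]splitr mulrDl lerD//; [exact: H1|exact: H2].
Qed.

Lemma flatZ us vs k x0 rho c f : flat us vs k x0 rho f ->
  flat us vs k x0 rho (fun x => c * f x).
Proof.
move=> ff eps e0; have c0 : 0 < `|c| + 1 by rewrite ltr_wpDl.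
have [h1 h10 H1] := ff _ (divr_gt0 e0 c0); exists h1 => // h hgt0 hh1 x xr.
rewrite /fdiff2 !fdiffsZ -mulrBr normrM.
have := ler_wpM2l (ltW c0) (H1 h hgt0 hh1 x xr).
rewrite mulrA mulrCA mulfV ?gt_eqF// mulr1; apply: le_trans.
by rewrite ler_wpM2r// lerDl.
Qed.

Lemma eq_flat us vs k x0 rho r f g : rho < r ->
  {in us, forall v, `|v| <= 1} -> {in vs, forall v, `|v| <= 1} ->
  size us = k -> size vs = k -> (forall y, `|y - x0| < r -> f y = g y) ->
  flat us vs k x0 rho f -> flat us vs k x0 rho g.
Proof.
move=> rr us1 vs1 us_k vs_k fg ff eps e0; have [h1 h10 H1] := ff _ e0.
have k0 : 0 < k.+1%:R :> R by rewrite ltr0n.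
exists (Num.min h1 ((r - rho) / k.+1%:R)); first by rewrite lt_min h10 divr_gt0// subr_gt0.
move=> h hgt0; rewrite lt_min => /andP[hh1 hh2] x xr.
have E ws : size ws = k -> {in ws, forall v, `|v| <= 1} -> fdiffs h ws g x = fdiffs h ws f x.
  move=> wsk ws1; apply: eq_fdiffs => //; first exact: ltW.
  move=> y yx; apply/esym/fg.
  rewrite -(subrK x y) -addrA (le_lt_trans (ler_normD _ _))//.
  move: hh2; rewrite ltr_pdivlMr// -natr1 mulrDr mulr1; move: yx; rewrite wsk; lra.
by rewrite /fdiff2 !E//; exact: H1.
Qed.

(** The falling factorial a (a - 1) ... (a - k + 1). *)
Fixpoint falling (k : nat) (a : R) : R :=
  if k is k'.+1 then a * falling k' (a - 1) else 1.

Variable lin : V -> R.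
Hypothesis linD : forall x y, lin (x + y) = lin x + lin y.
Hypothesis linZ : forall t x, lin (t *: x) = t * lin x.

Lemma is_derive_ridge c a x v : 0 < lin x ->
  is_derive x v (fun y => c * lin y `^ a) (c * a * lin v * lin x `^ (a - 1)).
Proof.
move=> x0.
pose phi (s : R) := c * (lin x + s * lin v) `^ a.
have dphi : is_derive (0 : R) 1 phi (c * a * lin v * lin x `^ (a - 1)).
  have daff : is_derive (0 : R) 1 (fun s : R => lin x + s * lin v) (lin v).
    by apply: is_derive_eq; rewrite scaler0 !add0r mul1r; exact: mulr1.
  have aff0 : 0 < lin x + 0 * lin v by rewrite mul0r addr0.
  have dp := @is_derive1_comp R (fun y : R => y `^ a) (fun s : R => lin x + s * lin v) 0 _ _
    (is_derive1_powR a aff0) daff.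
  have := is_deriveZ c dp; rewrite mul0r addr0 => /is_derive_eq; apply.
  by rewrite /GRing.scale/=; ring.
move: dphi => [df <-].
have E : (fun h : R => h^-1 *: ((((fun y => c * lin y `^ a) \o shift x) (h *: v)) - (c * lin x `^ a)))
  = (fun h : R => h^-1 *: (((phi \o shift 0) (h *: 1)) - phi 0)).
  apply/funext => h /=; rewrite /phi mul0r !addr0 [h *: 1]mulr1 linD linZ.
  by rewrite [h * _ + _]addrC.
by split; [rewrite /derivable E | rewrite /derive E].
Qed.

Lemma ridge_derive_chain (O : set V) vs c a : (forall x, O x -> 0 < lin x) ->
  derive_chain O vs (fun x => c * lin x `^ a)
    (fun x => c * falling (size vs) a * \prod_(v <- vs) lin v *
              lin x `^ (a - (size vs)%:R)).
Proof.
move=> O0; elim: vs c a => [|v vs IH] c a /=.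
  by apply/funext => x; rewrite big_nil subr0 !mulr1.
exists (fun x => c * a * lin v * lin x `^ (a - 1)).
  by move=> x /O0; exact: is_derive_ridge.
have := IH (c * a * lin v) (a - 1); congr derive_chain; apply/funext => x.
by rewrite big_cons -natr1 opprD addrA addrAC; congr (_ * _ ); ring.
Qed.

Lemma powR_lipschitz (b s0 s t : R) : b <= 0 -> 0 < s0 -> s0 <= s -> s0 <= t ->
  `|s `^ b - t `^ b| <= `|b| * s0 `^ (b - 1) * `|s - t|.
Proof.
move=> b0 s00; wlog st : s t / s < t.
  move=> H s0s s0t; have [st|ts|->] := ltgtP s t; first exact: H.
    by rewrite distrC [`|s - t|]distrC; apply: H.
  by rewrite !subrr normr0 mulr0.
move=> s0s s0t.
have d (x : R) : s0 <= x -> is_derive x 1 (fun y : R => y `^ b) (b * x `^ (b - 1)).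
  by move=> s0x; apply: is_derive1_powR; rewrite (lt_le_trans s00).
have [z|z|y] := @MVT R (fun y : R => y `^ b) (fun x : R => b * x `^ (b - 1)) s t st.
- by rewrite in_itv/= => /andP[sz _]; apply: d; rewrite (le_trans s0s)// ltW.
- apply: derivable_within_continuous z => y; rewrite in_itv/= => /andP[sx _].
  by have [] := d y (le_trans s0s sx).
rewrite in_itv/= => /andP[sy yt]; rewrite distrC => ->.
rewrite normrM [`|t - s|]distrC ler_wpM2r// normrM ler_wpM2l//.
rewrite ger0_norm ?powR_ge0// (_ : b - 1 = - (1 - b)); last by ring.
rewrite !powRN.
rewrite lef_pV2 ?posrE ?powR_gt0//; [|by rewrite (lt_le_trans s00) ?(le_trans s0s)// ltW].
have s0y : s0 <= y by rewrite (le_trans s0s)// ltW.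
have b1 : 0 <= 1 - b by rewrite subr_ge0 (le_trans b0).
by apply: (ge0_ler_powR b1); rewrite ?nnegrE ?(ltW s00)// (le_trans (ltW s00)).
Qed.

(** An iterated difference of lin^a is, up to powers of the step, a derivative at
    a nearby point, which depends on the directions only through their number
    and the product of the values of [lin]. For [us] and [vs] these agree, and
    what remains is the variation of lin^(a - k) between two nearby points. *)
Lemma flat_ridge us vs k x0 rho r c a s0 M : rho < r -> 0 < s0 -> a <= 0 ->
  (forall x, `|lin x| <= M * `|x|) ->
  (forall x, `|x - x0| < r -> s0 <= lin x) ->
  {in us, forall v, `|v| <= 1} -> {in vs, forall v, `|v| <= 1} ->
  size us = k -> size vs = k ->
  \prod_(v <- us) lin v = \prod_(v <- vs) lin v ->
  flat us vs k x0 rho (fun x => c * lin x `^ a).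
Proof.
move=> rr s00 a0 linM lin0 us1 vs1 us_k vs_k usvs eps e0.
pose C := c * falling k a * \prod_(v <- us) lin v.
pose b := a - k%:R.
have b0 : b <= 0 by rewrite subr_le0 (le_trans a0).
pose L := `|C| * (`|b| * s0 `^ (b - 1) * (`|M| * (2 * k%:R))).
have L0 : 0 <= L by rewrite !mulr_ge0// powR_ge0.
have k0 : 0 < k.+1%:R :> R by rewrite ltr0n.
(* The first bound makes [L * h] smaller than [eps]; the second keeps all the
   points of the differences inside the ball of radius [r]. *)
exists (Num.min (eps / (L + 1)) ((r - rho) / k.+1%:R)).
  by rewrite lt_min !divr_gt0// ?subr_gt0// ltr_wpDl.
move=> h hgt0; rewrite lt_min => /andP[hh1 hh2] x xr.
have xr' : `|x - x0| + h * k%:R < r.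
  by move: hh2; rewrite ltr_pdivlMr// -natr1 mulrDr mulr1; lra.
have chain ws := @ridge_derive_chain [set y | `|y - x0| < r] ws c a
  (fun x xr => lt_le_trans s00 (lin0 x xr)).
have mvt ws : {in ws, forall v, `|v| <= 1} -> size ws = k ->
    exists2 y, `|y - x| <= h * k%:R & fdiffs h ws (fun x => c * lin x `^ a) x =
      h ^+ k * (c * falling k a * \prod_(v <- ws) lin v * lin y `^ b).
  move=> ws1 wsk; have := fdiffs_mvt hgt0 ws1 (chain ws); rewrite wsk => /(_ x xr').
  exact.
have [y1 y1x y1E] := mvt us us1 us_k; have [y2 y2x y2E] := mvt vs vs1 vs_k.
have hk0 : 0 <= h ^+ k by rewrite exprn_ge0// ltW.
rewrite /fdiff2 y1E y2E -usvs -!mulrBr -/C -/b normrM ger0_norm//.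
rewrite mulrC ler_wpM2r// normrM.
have yr y : `|y - x| <= h * k%:R -> s0 <= lin y.
  move=> yx; apply: lin0; apply: le_lt_trans xr'.
  have -> : y - x0 = (x - x0) + (y - x) by rewrite [RHS]addrC addrA subrK.
  by rewrite (le_trans (ler_normD _ _))// lerD2l.
have H1 := powR_lipschitz b0 s00 (yr _ y1x) (yr _ y2x).
have H2 : `|lin y1 - lin y2| <= `|M| * (2 * k%:R) * h.
  rewrite -[- lin y2]mulN1r -linZ -linD scaleN1r.
  apply: (le_trans (linM _)); apply: (le_trans (ler_wpM2r _ (ler_norm M))) => //.
  rewrite -mulrA ler_wpM2l//.
  have -> : y1 - y2 = (y1 - x) - (y2 - x) by rewrite opprB addrA subrK.
  by have := ler_normB (y1 - x) (y2 - x); lra.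
apply: (@le_trans _ _ (L * h)).
  rewrite /L -!mulrA ler_wpM2l//; apply: (le_trans H1); rewrite -mulrA ler_wpM2l// ler_wpM2l ?powR_ge0//.
  by rewrite !mulrA in H2 *.
move: hh1; rewrite ltr_pdivlMr ?ltr_wpDl// mulrC mulrDl mul1r => hh1.
by apply: le_trans (ltW hh1); rewrite lerDl ltW.
Qed.
End FlatFunctions.

(** * Polynomials as linear forms in their coefficients *)

Section RowVectorNorm.
Variables (R : realType) (m : nat).
Implicit Types x : 'rV[R]_m.

Lemma rV_norm_le x (a : R) : 0 <= a -> (forall i, `|x 0 i| <= a) -> `|x| <= a.
Proof.
move=> a0 xa; rewrite /Num.Def.normr/= mx_normrE.
by apply: bigmax_le => // -[i j] _ /=; rewrite ord1.
Qed.

Lemma rV_norm_ge x i : `|x 0 i| <= `|x|.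
Proof.
rewrite [leRHS]/Num.Def.normr/= mx_normrE.
exact: (le_bigmax _ (fun ij : 'I_1 * 'I_m => `|x ij.1 ij.2|) (0, i)).
Qed.

Lemma rV_norm_lt x (a : R) : 0 < a -> (forall i, `|x 0 i| < a) -> `|x| < a.
Proof.
move=> a0 xa; rewrite /Num.Def.normr/= mx_normrE.
by apply: bigmax_lt => // -[i j] _ /=; rewrite ord1.
Qed.

Lemma rV_norm_delta i : `|delta_mx 0 i : 'rV[R]_m| <= 1.
Proof.
by apply: rV_norm_le => // j; rewrite mxE normr_nat lern1 leq_b1.
Qed.
End RowVectorNorm.

Lemma near_pairP (R : realType) (X Y : normedModType R) (x : X) (y : Y) (P : X * Y -> Prop) :
  (\forall w \near (x, y), P w) <->
  exists2 r : R, 0 < r & forall x' y', `|x' - x| < r -> `|y' - y| < r -> P (x', y').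
Proof.
split=> [/nbhs_ballP[r r0 H]|[r r0 H]].
  exists r => // x' y' xr yr; apply: H; split => /=.
    by rewrite -ball_normE/= distrC.
  by rewrite -ball_normE/= distrC.
apply/nbhs_ballP; exists r => // -[x' y'] [/=].
by rewrite -!ball_normE/= => xr yr; apply: H; rewrite distrC.
Qed.

Section CoordinateDirections.
Variables (R : realType) (m : nat).
Implicit Types u : multinom m.

(** The coordinate vectors, each repeated according to [u]; reversed because
    [partials] applies the derivations of the last coordinate first. *)
Definition directions u : seq 'rV[R]_m :=
  rev (flatten [seq nseq (u j) (delta_mx 0 j) | j <- enum 'I_m]).

Lemma partialsE u (f : 'rV[R]_m -> R) : partials u f = iterD (directions u) f.
Proof.
rewrite /partials /iterD /directions foldl_rev.
elim: (enum 'I_m) => //= j s ->; rewrite foldr_cat.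
by elim: (u j) => //= k ->.
Qed.

Lemma size_directions u : size (directions u) = mdeg u.
Proof.
rewrite size_rev size_flatten /shape -map_comp sumnE big_map mdegE big_enum/=.
by apply: eq_bigr => j _; rewrite size_nseq.
Qed.

Lemma directions_norm u : {in directions u, forall v, `|v| <= 1}.
Proof.
move=> v; rewrite mem_rev => /flattenP[s /mapP[j _ ->]] /nseqP[-> _].
exact: rV_norm_delta.
Qed.

Lemma prod_directions u (lin : 'rV[R]_m -> R) :
  \prod_(v <- directions u) lin v = \prod_j lin (delta_mx 0 j) ^+ u j.
Proof.
rewrite /directions (perm_big _ (permEl (perm_rev _)))/=.
rewrite big_flatten/= big_map big_enum/=; apply: eq_bigr => j _.
by rewrite big_nseq iter_mulr_1.
Qed.
End CoordinateDirections.

Section CoefficientFamily.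
Variables (R : realType) (n m : nat) (A : m.-tuple (multinom n)).
Implicit Types (x y : 'rV[R]_n) (z : 'rV[R]_m) (u v : multinom m).

Definition mono_eval (a : multinom n) x : R := \prod_i x 0 i ^+ a i.

Lemma poly_of_coefs_eval z x :
  mpoly_eval (poly_of_coefs A z) x = \sum_(j < m) z 0 j * mono_eval (tnth A j) x.
Proof.
rewrite /mpoly_eval /poly_of_coefs raddf_sum /=; apply: eq_bigr => j _.
by rewrite mevalZ mevalX.
Qed.

Definition coef_form x z : R := mpoly_eval (poly_of_coefs A z) x.

Lemma coef_formD x z z' : coef_form x (z + z') = coef_form x z + coef_form x z'.
Proof.
rewrite /coef_form !poly_of_coefs_eval -big_split/=.
by apply: eq_bigr => j _; rewrite mxE mulrDl.
Qed.

Lemma coef_formZ x t z : coef_form x (t *: z) = t * coef_form x z.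
Proof.
rewrite /coef_form !poly_of_coefs_eval mulr_sumr.
by apply: eq_bigr => j _; rewrite mxE mulrA.
Qed.

Lemma coef_form_delta x j : coef_form x (delta_mx 0 j) = mono_eval (tnth A j) x.
Proof.
rewrite /coef_form poly_of_coefs_eval (bigD1 j)//= big1 => [|i ij].
  by rewrite mxE !eqxx mul1r addr0.
by rewrite mxE (negbTE ij) andbF mul0r.
Qed.

Lemma coef_form_bounded x :
  exists M : R, forall z, `|coef_form x z| <= M * `|z|.
Proof.
exists (\sum_(j < m) `|mono_eval (tnth A j) x|) => z.
rewrite /coef_form poly_of_coefs_eval (le_trans (ler_norm_sum _ _ _))// mulr_suml.
apply: ler_sum => j _; rewrite normrM mulrC ler_wpM2l//; exact: rV_norm_ge.
Qed.

Lemma coef_form_homog d z t x : (forall a, a \in tval A -> mdeg a = d) ->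
  coef_form (t *: x) z = t ^+ d * coef_form x z.
Proof.
move=> Ad; rewrite /coef_form !poly_of_coefs_eval mulr_sumr.
apply: eq_bigr => j _; rewrite mulrCA; congr (_ * _).
rewrite -(Ad (tnth A j)) ?mem_tnth// mdegE /mono_eval -prodrXr -big_split/=.
by apply: eq_bigr => i _; rewrite mxE exprMn.
Qed.

Lemma continuous_coef_form :
  continuous (fun w : 'rV[R]_m * 'rV[R]_n => coef_form w.2 w.1).
Proof.
rewrite (_ : (fun w => _) = fun w : 'rV[R]_m * 'rV[R]_n =>
    \sum_(j < m) w.1 0 j * mono_eval (tnth A j) w.2); last first.
  by apply/funext => w; rewrite /coef_form poly_of_coefs_eval.
apply: continuous_big => [|j _]; first exact: add_continuous.
move=> w; apply: cvgM.
  apply: (@cvg_comp _ _ _ fst (fun z : 'rV[R]_m => z 0 j)); first exact: cvg_fst.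
  exact: coord_continuous.
move: w; apply: continuous_big => [w|i _ w].
  by apply: cvgM; [exact: cvg_fst | exact: cvg_snd].
apply: (@cvg_comp _ _ _ (fun w : 'rV[R]_m * 'rV[R]_n => w.2 0 i) (fun t : R => t ^+ tnth A j i)).
  apply: (@cvg_comp _ _ _ snd (fun z : 'rV[R]_n => z 0 i)); first exact: cvg_snd.
  exact: coord_continuous.
exact: exprn_continuous.
Qed.

Lemma toric_exponents u v : toric_relation A u v -> forall i,
  (\sum_(j < m) tnth A j i * u j = \sum_(j < m) tnth A j i * v j)%N.
Proof.
move=> uv i; apply/eqP; rewrite -eqz_nat; apply/eqP.
have := uv i; under eq_bigr do rewrite mulrBl.
rewrite sumrB => /eqP; rewrite subr_eq0 => /eqP.
rewrite !(big_morph Posz PoszD (erefl _)).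
move=> E; apply: etrans (etrans _ E) _; apply: eq_bigr => j _; first by rewrite PoszM mulrC.
by rewrite PoszM mulrC.
Qed.

Lemma toric_prod u v x : toric_relation A u v ->
  \prod_(w <- directions R u) coef_form x w = \prod_(w <- directions R v) coef_form x w.
Proof.
move=> uv; rewrite !prod_directions.
suff H (w : multinom m) : \prod_j coef_form x (delta_mx 0 j) ^+ w j =
    \prod_i x 0 i ^+ (\sum_(j < m) tnth A j i * w j)%N.
  by rewrite !H; apply: eq_bigr => i _; rewrite (toric_exponents uv).
under eq_bigr do rewrite coef_form_delta -prodrXl.
rewrite exchange_big/=; apply: eq_bigr => i _.
by rewrite -prodrXr; apply: eq_bigr => j _; rewrite exprM.
Qed.

Lemma toric_mdeg d u v : (0 < d)%N -> (forall a, a \in tval A -> mdeg a = d) ->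
  toric_relation A u v -> mdeg u = mdeg v.
Proof.
move=> d0 Ad uv; apply/eqP; rewrite -(eqn_pmul2l d0); apply/eqP.
suff H (w : multinom m) : (d * mdeg w = \sum_(i < n) \sum_(j < m) tnth A j i * w j)%N.
  by rewrite !H; apply: eq_bigr => i _; exact: toric_exponents.
rewrite exchange_big/= mdegE big_distrr/=; apply: eq_bigr => j _.
by rewrite -big_distrl/= -mdegE Ad// mem_tnth.
Qed.

End CoefficientFamily.

(** * Cones inside the hyperbolicity cones *)

Section ConnectedComponents.
Variables (R : realType) (n : nat).

Lemma segment_connected_component (P : set 'rV[R]_n) (e x : 'rV[R]_n) :
  (forall s : R, 0 <= s -> s <= 1 -> P ((1 - s) *: e + s *: x)) -> connected_component P e x.
Proof.
move=> Px; pose f (s : R) : 'rV[R]_n := e + s *: (x - e).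
have fE s : f s = (1 - s) *: e + s *: x.
  by rewrite /f scalerBr scalerBl scale1r addrA addrAC.
have cf : continuous f.
  move=> s; apply: cvgD; first exact: cvg_cst.
  by apply: cvgZr_tmp; exact: cvg_id.
apply: (@connected_component_max _ P (f @` `[0, 1]%classic) e).
- by exists 0; rewrite /= ?in_itv/= ?lexx ?ler01// /f scale0r addr0.
- by move=> _ [s + <-]; rewrite /= in_itv/= => /andP[s0 s1]; rewrite fE; exact: Px.
- apply: connected_continuous_connected; first exact: segment_connected.
  exact: continuous_subspaceT.
by exists 1; rewrite /= ?in_itv/= ?lexx ?ler01// /f scale1r addrC subrK.
Qed.

(** The image of a connected set by [f] is an interval, and it avoids 0. *)
Lemma connected_component_pos (P : set 'rV[R]_n) (e x : 'rV[R]_n) (f : 'rV[R]_n -> R) :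
  continuous f -> (forall y, P y -> f y != 0) -> 0 < f e ->
  connected_component P e x -> 0 < f x.
Proof.
move=> cf f0 fe [B [Be BP cB] Bx].
have cfB : connected (f @` B).
  by apply: connected_continuous_connected => //; exact: continuous_subspaceT.
rewrite ltNge; apply/negP => fx.
have /connected_intervalP := cfB.
move=> /(_ (f x) (f e)) H; have : (f @` B) 0.
  apply: H; [by exists x | by exists e|].
  by rewrite fx ltW.
by move=> [y /BP/f0/eqP + fy].
Qed.
End ConnectedComponents.

Section OpenCone.
Variables (R : realType) (n : nat) (e : 'rV[R]_n) (delta : R).
Hypothesis delta0 : 0 < delta.
Implicit Types (x y : 'rV[R]_n).

(** The open convex cone spanned by the ball of radius [delta] around [e]. *)
Definition cone_around : set 'rV[R]_n :=
  [set x | exists2 t : R, 0 < t & `|x - t *: e| < delta * t].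

Lemma cone_around_ball x : `|x - e| < delta -> cone_around x.
Proof. by move=> xe; exists 1; rewrite ?scale1r ?mulr1. Qed.

Lemma cone_aroundD x y : cone_around x -> cone_around y -> cone_around (x + y).
Proof.
move=> [t t0 xt] [s s0 ys]; exists (t + s); first exact: addr_gt0.
rewrite scalerDl opprD addrACA mulrDr.
by rewrite (le_lt_trans (ler_normD _ _))// ltrD.
Qed.

Lemma cone_aroundZ (s : R) x : 0 < s -> cone_around x -> cone_around (s *: x).
Proof.
move=> s0 [t t0 xt]; exists (s * t); first exact: mulr_gt0.
by rewrite -scalerA -scalerBr normrZ gtr0_norm// mulrCA ltr_pM2l.
Qed.

Lemma cone_around_connected_component (P : set 'rV[R]_n) :
  cone_around `<=` P -> cone_around `<=` connected_component P e.
Proof.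
move=> KP x Kx.
have Ke : cone_around e by apply: cone_around_ball; rewrite subrr normr0.
apply: segment_connected_component => s s0 s1; apply: KP.
have [->|s0'] := eqVneq s 0; first by rewrite subr0 scale1r scale0r addr0.
have [->|s1'] := eqVneq s 1; first by rewrite subrr scale0r add0r scale1r.
apply: cone_aroundD; apply: cone_aroundZ => //.
  by rewrite subr_gt0 lt_neqAle s1'.
by rewrite lt_neqAle eq_sym s0'.
Qed.
End OpenCone.

(** * Integrals of nonnegative functions and Borel versions of Riesz kernels *)

Section NonnegativeIntegrals.
Context d (T : measurableType d) (R : realType) (mu : {measure set T -> \bar R}).
Local Open Scope ereal_scope.

Import HBNNSimple.

(** The integral of a nonnegative function is a supremum over Borel simple
    functions, hence defined but not obviously invariant under modifications on
    a null set when the function is not measurable. Lowering the function to a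
    measurable one on a null set is harmless, since a simple function below it
    is almost everywhere below the new one. *)
Lemma ge0_integral_null_lower (f h : T -> \bar R) (N : set T) :
  measurable N -> mu N = 0 -> measurable_fun setT h ->
  (forall t, 0 <= h t) -> (forall t, h t <= f t) -> (forall t, ~ N t -> f t = h t) ->
  \int[mu]_t f t = \int[mu]_t h t.
Proof.
move=> mN N0 mh h0 hf fh.
have f0 t : 0 <= f t by exact: le_trans (hf t).
apply/eqP; rewrite eq_le; apply/andP; split; last first.
  rewrite !ge0_integralTE//; apply: le_ereal_sup => _ [s sh <-].
  by exists s => // t; exact: le_trans (hf t).
rewrite [leLHS]ge0_integralTE//; apply: ub_ereal_sup => _ [s sf <-].
rewrite -integralT_nnsfun; apply: ae_ge0_le_integral => //.
- by move=> t _; rewrite lee_fin; exact: fun_ge0.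
- by apply/measurable_EFinP; exact: measurable_funPT.
exists N; split => // t /= H; apply: contrapT => Nt; apply: H => _.
by rewrite -fh.
Qed.

End NonnegativeIntegrals.

Section RintegralLemmas.
Context d (T : measurableType d) (R : realType) (mu : {measure set T -> \bar R}).

Lemma le_Rintegral_off_null (f1 f2 : T -> R) (N : set T) :
  measurable N -> mu N = 0%E ->
  mu.-integrable setT (EFin \o f1) -> mu.-integrable setT (EFin \o f2) ->
  (forall t, ~ N t -> f1 t <= f2 t) ->
  \int[mu]_t f1 t <= \int[mu]_t f2 t.
Proof.
move=> mN N0 i1 i2 f12; rewrite /Rintegral.
rewrite (negligible_integral mN measurableT i1 N0).
rewrite (negligible_integral mN measurableT i2 N0).
apply: le_Rintegral.
- exact: measurableD.
- by apply: integrableS i1 => //; exact: measurableD.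
- by apply: integrableS i2 => //; exact: measurableD.
by move=> t [_ /f12].
Qed.

Lemma integrable_lin (c : R) (f : T -> R) :
  mu.-integrable setT (EFin \o f) -> mu.-integrable setT (EFin \o (fun t => c * f t)).
Proof.
by move=> /(integrableZl measurableT c); apply: eq_integrable => // t _ /=; rewrite EFinM.
Qed.

Lemma integrable_wsum (I : eqType) (s : seq I) (w : I -> R) (F : I -> T -> R) :
  (forall i, i \in s -> mu.-integrable setT (EFin \o F i)) ->
  mu.-integrable setT (EFin \o (fun t => \sum_(i <- s) w i * F i t)) /\
  \int[mu]_t (\sum_(i <- s) w i * F i t) = \sum_(i <- s) w i * \int[mu]_t F i t.
Proof.
elim: s => [|i s IH] iF.
  split; first by under eq_fun do rewrite big_nil; exact: integrable0.
  under eq_Rintegral do rewrite big_nil.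
  by rewrite big_nil Rintegral_cst// mul0r.
have [IH1 IH2] := IH (fun j js => iF j (mem_behead (js : j \in behead (i :: s)))).
have iFi := iF i (mem_head _ _); have iwF := integrable_lin (w i) iFi.
have E t : \sum_(j <- i :: s) w j * F j t = w i * F i t + \sum_(j <- s) w j * F j t.
  by rewrite big_cons.
split.
  have := integrableD measurableT iwF IH1.
  by apply: eq_integrable => // t _ /=; rewrite E.
under eq_Rintegral do rewrite E.
by rewrite RintegralD// RintegralZl// IH2 big_cons.
Qed.

Lemma null_seq_union (I : eqType) (s : seq I) (N : I -> set T) :
  (forall i, i \in s -> measurable (N i) /\ mu (N i) = 0%E) ->
  exists N0, [/\ measurable N0, mu N0 = 0%E & forall i, i \in s -> N i `<=` N0].
Proof.
elim: s => [|i s IH] sN; first by exists set0.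
have [N0 [mN0 N00 sN0]] := IH (fun j js => sN j (mem_behead (js : j \in behead (i :: s)))).
have [mNi Ni0] := sN i (mem_head _ _).
exists (N i `|` N0); split; first exact: measurableU.
- have E0 : (mu (N i) + mu N0 = 0)%E by rewrite Ni0 N00 adde0.
  apply/eqP; rewrite eq_le measure_ge0 andbT -E0; exact: measureU2.
- move=> j; rewrite inE => /predU1P[-> t|/sN0 H t]; first by left.
  by move=> /H; right.
Qed.
End RintegralLemmas.

Section Boxes.
Variable R : realType.

Definition tuple_box n (c : 'I_n -> R) (r : R) : set (n.-tuple (measurableTypeR R)) :=
  [set t | forall i, `|tnth t i - c i| < r].

Lemma itv_ball (c r : R) : [set x : measurableTypeR R | `|x - c| < r] = `]c - r, c + r[%classic.
Proof.
by apply/seteqP; split=> x /=; rewrite in_itv/= -ltr_distlC distrC.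
Qed.

Lemma measurable_tuple_box n (c : 'I_n -> R) r : measurable (tuple_box c r).
Proof.
rewrite (_ : tuple_box c r = \bigcap_(i in [set: 'I_n])
    ((fun t : n.-tuple (measurableTypeR R) => tnth t i) @^-1` [set x | `|x - c i| < r])).
  apply: fin_bigcap_measurable => // i _.
  rewrite -[X in measurable X]setTI; apply: measurable_tnth => //.
  by rewrite itv_ball; exact: measurable_itv.
by apply/seteqP; split=> [t tc i _|t tc i]; exact: tc.
Qed.

Lemma lebesgue_tuple_box n (c : 'I_n -> R) r : 0 < r ->
  lebesgue_tuple (tuple_box c r) = ((r *+ 2) ^+ n)%:E.
Proof.
move=> r0; elim: n c => [|n IH] c.
  by rewrite /= diracE mem_set// => -[].
rewrite /= /pushforward.
rewrite (_ : _ @^-1` _ = `]c ord0 - r, c ord0 + r[%classic `*` tuple_box (fun i => c (lift ord0 i)) r); last first.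
  rewrite -itv_ball; apply/seteqP; split=> [[x t] H|[x t] [/= Hx Ht] i]; last first.
    have [j ->|->] := unliftP ord0 i; last by rewrite /cons_pair.
    by rewrite /cons_pair/= tnthS; exact: Ht.
  split=> /=; first exact: (H ord0).
  by move=> j; have := H (lift ord0 j); rewrite /cons_pair/= tnthS.
rewrite product_measure1E//; last exact: measurable_tuple_box.
rewrite [X in (_ * X)%E](IH (fun i => c (lift ord0 i))) [X in (X * _)%E]lebesgue_measure_itv/= lte_fin ltrD2l gtrN//.
by rewrite -EFinD -EFinM exprS; congr (_ * _)%:E; ring.
Qed.
Lemma lebesgue_tuple_origin n : (0 < n)%N ->
  let N := [set t : n.-tuple (measurableTypeR R) | forall i, tnth t i = 0] in measurable N /\ lebesgue_tuple N = 0%E.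
Proof.
move=> n0 N; have mN : measurable N.
  rewrite (_ : N = \bigcap_(i in [set: 'I_n])
      ((fun t : n.-tuple (measurableTypeR R) => tnth t i) @^-1` [set 0])).
    apply: fin_bigcap_measurable => // i _.
    by rewrite -[X in measurable X]setTI; apply: measurable_tnth.
  by apply/seteqP; split=> [t tc i _|t tc i]; [exact: tc | exact: (tc i)].
split => //; apply/eqP; rewrite eq_le measure_ge0 andbT.
apply/lee_addgt0Pr => eps eps0; rewrite add0e.
pose s := Num.min eps 1.
have s0 : 0 < s by rewrite lt_min eps0/=.
have s1 : s <= 1 by rewrite ge_min lexx orbT.
have s20 : 0 < s / 2 by rewrite divr_gt0.
apply: (@le_trans _ _ (@lebesgue_tuple R n (tuple_box (fun=> 0) (s / 2)))).
  apply: le_measure; rewrite ?inE//; first exact: measurable_tuple_box.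
  by move=> t Nt i; rewrite Nt subrr normr0.
have s2E : s / 2 *+ 2 = s by rewrite -[LHS]mulr_natr divfK.
rewrite lebesgue_tuple_box// lee_fin s2E.
apply: (@le_trans _ _ s); last by rewrite ge_min lexx.
by rewrite -[n]prednK// exprS ler_piMr ?(ltW s0)// exprn_ile1// ltW.
Qed.

End Boxes.

Section RieszKernelRegularization.
Variables (R : realType) (n : nat).
Notation T := (n.-tuple (measurableTypeR R)).
Notation mu := (@lebesgue_tuple R n).

Lemma measurable_dotrow (x : 'rV[R]_n) :
  measurable_fun setT (fun t : T => dotrow (row_of_tuple t) x).
Proof.
apply: measurable_sum => i; apply: measurable_funM; last exact: measurable_cst.
under eq_fun do rewrite mxE.
exact: measurable_tnth.
Qed.

Lemma measurable_exp_dotrow (x : 'rV[R]_n) :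
  measurable_fun setT (fun t : T => expR (- dotrow (row_of_tuple t) x)).
Proof.
by apply: measurableT_comp => //; apply: measurableT_comp => //; exact: measurable_dotrow.
Qed.

(** A Riesz kernel agrees almost everywhere with a Borel function; setting the
    latter to 0 on an exceptional null set puts it below the kernel everywhere,
    so that it vanishes outside the dual cone as well. *)
Lemma riesz_kernel_borel (p : mpoly n R) (alpha : R) (C : set 'rV[R]_n)
    (q : 'rV[R]_n -> R) : is_riesz_kernel p alpha C q ->
  exists (g : T -> R) (N : set T), [/\
    [/\ measurable_fun setT g, measurable N & mu N = 0%E],
    forall t, 0 <= g t,
    forall t, ~ dual_cone C (row_of_tuple t) -> g t = 0,
    forall t, ~ N t -> q (row_of_tuple t) = g t &
    forall x, C x -> (\int[mu]_t (expR (- dotrow (row_of_tuple t) x) * g t)%:E =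
      (neg_power p alpha x)%:E)%E].
Proof.
move=> [q0 qC [g0 mg0 [N [mN N0 qg]]] qL].
have qg0 t : ~ N t -> q (row_of_tuple t) = g0 t.
  by move=> Nt; apply: contrapT => H; exact/Nt/qg.
pose g t := g0 t * \1_(~` N) t.
have gE t : ~ N t -> g t = q (row_of_tuple t).
  by move=> Nt; rewrite /g indicE mem_set// mulr1 qg0.
have gN t : N t -> g t = 0.
  by move=> Nt; rewrite /g indicE memNset ?mulr0//; apply.
have mg : measurable_fun setT g.
  by apply: measurable_funM => //; apply: measurable_indic; exact: measurableC.
have g_ge0 t : 0 <= g t.
  by have [/gN->//|/gE->] := pselect (N t).
have gq t : g t <= q (row_of_tuple t).
  by have [/gN->//|/gE->] := pselect (N t).
exists g, N; split => //.
- move=> t tC; have [/gN->//|/gE->] := pselect (N t); exact: qC.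
- by move=> t /gE.
move=> x Cx; rewrite -qL// /lebesgue_int.
apply/esym; rewrite [LHS]integral_mkcond.
rewrite (_ : _ \_ _ = fun t => (expR (- dotrow (row_of_tuple t) x) * q (row_of_tuple t))%:E); last first.
  apply/funext => t; rewrite patchE; case: ifPn => //; rewrite notin_setE => /= tC.
  by rewrite qC// mulr0.
apply: (ge0_integral_null_lower mN N0).
- apply/measurable_EFinP; apply: measurable_funM => //; exact: measurable_exp_dotrow.
- by move=> t; rewrite lee_fin mulr_ge0// expR_ge0.
- by move=> t; rewrite lee_fin ler_wpM2l// expR_ge0.
- by move=> t /gE ->.
Qed.
End RieszKernelRegularization.

(** * Combinations of exponentials with a peak *)

Section ExponentialCombinations.
Variables (R : realType) (n : nat).
Implicit Types (x y : 'rV[R]_n) (phi : 'rV[R]_n -> R) (K : set 'rV[R]_n).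

Lemma dotrowDr y x x' : dotrow y (x + x') = dotrow y x + dotrow y x'.
Proof. by rewrite /dotrow -big_split/=; apply: eq_bigr => i _; rewrite mxE mulrDr. Qed.

Lemma dotrowZr y t x : dotrow y (t *: x) = t * dotrow y x.
Proof. by rewrite /dotrow mulr_sumr; apply: eq_bigr => i _; rewrite mxE mulrCA. Qed.

Lemma dotrowBl y y' x : dotrow (y - y') x = dotrow y x - dotrow y' x.
Proof. by rewrite /dotrow -sumrB; apply: eq_bigr => i _; rewrite !mxE mulrBl. Qed.

Lemma dotrow_delta y i : dotrow y (delta_mx 0 i) = y 0 i.
Proof.
rewrite /dotrow (bigD1 i)//= big1 => [|j ji]; first by rewrite mxE !eqxx mulr1 addr0.
by rewrite mxE (negbTE ji) andbF mulr0.
Qed.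

Lemma continuous_dotrow x : continuous (fun y => dotrow y x).
Proof.
apply: continuous_big => [|i _]; first exact: add_continuous.
have ci : continuous (fun y : 'rV[R]_n => y 0 i) by exact: coord_continuous.
by move=> y; exact: cvgMr_tmp (ci y).
Qed.

Definition expw x y : R := expR (- dotrow y x).

Lemma expwD x x' y : expw (x + x') y = expw x y * expw x' y.
Proof. by rewrite /expw dotrowDr opprD expRD. Qed.

Lemma expw_gt0 x y : 0 < expw x y.
Proof. exact: expR_gt0. Qed.

Lemma continuous_expw x : continuous (expw x).
Proof.
move=> y; apply: (@continuous_comp _ _ _ (fun y => - dotrow y x) expR).
  by have := cvgN (@continuous_dotrow x y); exact.
exact: continuous_expR.
Qed.

Inductive exp_comb K : ('rV[R]_n -> R) -> Prop :=
| exp_comb_exp x : K x -> exp_comb K (expw x)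
| exp_combD phi psi : exp_comb K phi -> exp_comb K psi ->
    exp_comb K (fun y => phi y + psi y)
| exp_combZ c phi : exp_comb K phi -> exp_comb K (fun y => c * phi y).

(** Exponentials multiply by adding their exponents, which stay in a cone. *)
Lemma exp_combM K x phi : (forall x x', K x -> K x' -> K (x + x')) ->
  K x -> exp_comb K phi -> exp_comb K (fun y => expw x y * phi y).
Proof.
move=> KD Kx; elim=> [x' Kx'|f g _ IHf _ IHg|c f _ IH].
- rewrite (_ : (fun y => _) = expw (x + x')); first exact/exp_comb_exp/KD.
  by apply/funext => y; rewrite expwD.
- under eq_fun do rewrite mulrDr; exact: exp_combD.
- under eq_fun do rewrite mulrCA; exact: exp_combZ.
Qed.

Definition peak_factor x (a : R) y : R := 1 - (expw x y - a) ^+ 2.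

Lemma exp_comb_peak_factor K x a phi : (forall x x', K x -> K x' -> K (x + x')) ->
  K x -> exp_comb K phi -> exp_comb K (fun y => peak_factor x a y * phi y).
Proof.
move=> KD Kx cphi; have H f := @exp_combM K x f KD Kx.
have := exp_combD (exp_combD (exp_combZ (1 - a ^+ 2) cphi) (exp_combZ (2 * a) (H _ cphi)))
  (exp_combZ (-1) (H _ (H _ cphi))).
by congr exp_comb; apply/funext => y; rewrite /peak_factor; ring.
Qed.

(** As [x] ranges over enough vectors [xs], this is maximal exactly at [y0]. The
    square makes it nonnegative everywhere. *)
Definition peak (xs : seq 'rV[R]_n) y0 y : R :=
  \prod_(x <- xs) peak_factor x (expw x y0) y ^+ 2.

Lemma exp_comb_peak K xs y0 phi : (forall x x', K x -> K x' -> K (x + x')) ->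
  (forall x, x \in xs -> K x) -> exp_comb K phi ->
  exp_comb K (fun y => peak xs y0 y * phi y).
Proof.
move=> KD + cphi; elim: xs => [|x xs IH] Kxs.
  by under eq_fun do rewrite /peak big_nil mul1r.
have Kx : K x by apply: Kxs; rewrite mem_head.
have {}IH := IH (fun x' x'xs => Kxs x' (mem_behead (x'xs : x' \in behead (x :: xs)))).
have := exp_comb_peak_factor (expw x y0) KD Kx (exp_comb_peak_factor (expw x y0) KD Kx IH).
congr exp_comb; apply/funext => y.
by rewrite [in RHS]/peak big_cons expr2 -!mulrA.
Qed.

Lemma exp_comb_peakX K xs y0 e M : (forall x x', K x -> K x' -> K (x + x')) ->
  (forall x, x \in xs -> K x) -> K e ->
  exp_comb K (fun y => expw e y * peak xs y0 y ^+ M).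
Proof.
move=> KD Kxs Ke; elim: M => [|M IH].
  by under eq_fun do rewrite expr0 mulr1; exact: exp_comb_exp.
have := exp_comb_peak y0 KD Kxs IH; congr exp_comb; apply/funext => y.
by rewrite exprS mulrCA.
Qed.

Lemma peak_ge0 xs y0 y : 0 <= peak xs y0 y.
Proof. by apply: prodr_ge0 => x _; rewrite sqr_ge0. Qed.

Lemma peak_center xs y0 : peak xs y0 y0 = 1.
Proof.
by rewrite /peak big1// => x _; rewrite /peak_factor subrr expr0n subr0 expr1n.
Qed.

Lemma continuous_peak xs y0 : continuous (peak xs y0).
Proof.
apply: (@continuous_big _ _ (@GRing.mul R) 1) => [w|x _ y].
  by apply: cvgM; [exact: cvg_fst | exact: cvg_snd].
apply: (@continuous_comp _ _ _ (peak_factor x (expw x y0)) (fun t : R => t ^+ 2)); last first.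
  exact: exprn_continuous.
have c1 : {for y, continuous (fun y => (expw x y - expw x y0) ^+ 2)}.
  apply: (@continuous_comp _ _ _ (fun y => expw x y - expw x y0) (fun t : R => t ^+ 2)); last first.
    exact: exprn_continuous.
  exact: (cvgB (@continuous_expw x y) (cvg_cst (expw x y0))).
have c2 : {for y, continuous (cst 1 : 'rV[R]_n -> R)} by exact: cst_continuous.
exact: (continuousB c2 c1).
Qed.

Lemma expw_le1 x y : 0 <= dotrow y x -> expw x y <= 1.
Proof. by move=> yx; rewrite -expR0 ler_expR oppr_le0. Qed.

Lemma peak_factor_itv x y y0 : 0 <= dotrow y x -> 0 <= dotrow y0 x ->
  0 <= peak_factor x (expw x y0) y <= 1.
Proof.
move=> /expw_le1 s1 /expw_le1 a1; have := expw_gt0 x y; have := expw_gt0 x y0.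
rewrite /peak_factor => a0 s0; rewrite subr_ge0 gerBl sqr_ge0 andbT.
by rewrite -real_normK ?num_real// expr_le1// ler_norml; apply/andP; split; lra.
Qed.

Lemma peak_le xs y0 y x (delta : R) : 0 <= delta ->
  (forall x, x \in xs -> 0 <= dotrow y x /\ 0 <= dotrow y0 x) ->
  x \in xs -> delta <= `|expw x y - expw x y0| -> peak xs y0 y <= 1 - delta ^+ 2.
Proof.
move=> d0 xsP xxs dx.
have f01 x' : x' \in xs -> 0 <= peak_factor x' (expw x' y0) y ^+ 2 <= 1.
  move=> /xsP[yx y0x]; rewrite sqr_ge0/=.
  by have /andP[f0 f1] := peak_factor_itv yx y0x; rewrite expr_le1.
have fx : peak_factor x (expw x y0) y ^+ 2 <= 1 - delta ^+ 2.
  have [yx y0x] := xsP x xxs; have /andP[f0 f1] := peak_factor_itv yx y0x.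
  rewrite expr2 (@le_trans _ _ (peak_factor x (expw x y0) y))//; first by rewrite ler_piMl.
  by rewrite lerD2l lerN2 -[leRHS]real_normK ?num_real// lerXn2r ?nnegrE.
apply: le_trans fx; rewrite /peak (big_rem x xxs)/= ler_piMr ?sqr_ge0// big_seq.
apply: prodr_ile1 => x' /mem_rem; exact: f01.
Qed.

(** The exponentials at [y] and [y0] differ by the factor exp(- <y - y0, x>). *)
Lemma expw_separation x y y0 (eps : R) : 0 < eps -> eps <= `|dotrow (y - y0) x| ->
  expw x y0 * (1 - expR (- eps)) <= `|expw x y - expw x y0|.
Proof.
move=> eps0; rewrite dotrowBl; set s := dotrow y x; set s0 := dotrow y0 x => H.
have -> : expw x y = expw x y0 * expR (- (s - s0)).
  by rewrite /expw -expRD opprB addKr.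
rewrite -{3}[expw x y0]mulr1 -mulrBr normrM ger0_norm ?(ltW (expw_gt0 _ _))//.
rewrite ler_wpM2l ?(ltW (expw_gt0 _ _))//.
have [ss|ss] := lerP 0 (s - s0).
  rewrite ger0_norm// in H; rewrite distrC (le_trans _ (ler_norm _))//.
  by rewrite lerD2l lerN2 ler_expR lerN2.
rewrite ltr0_norm// in H; rewrite (le_trans _ (ler_norm _))//.
have h1 : 1 + eps <= expR (- (s - s0)).
  by apply: le_trans (expR_ge1Dx _); rewrite lerD2l.
have h2 : 1 - eps <= expR (- eps) by exact: expR_ge1Dx.
by lra.
Qed.

Lemma seq_positive_lower_bound (I : eqType) (s : seq I) (f : I -> R) (b : R) : 0 < b ->
  (forall i, i \in s -> 0 < f i) ->
  exists2 d : R, 0 < d <= b & forall i, i \in s -> d <= f i.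
Proof.
move=> b0; elim: s => [|i s IH] sf; first by exists b; rewrite ?b0/=.
have [d /andP[d0 db] ds] := IH (fun j js => sf j (mem_behead (js : j \in behead (i :: s)))).
exists (Num.min d (f i)); first by rewrite lt_min d0 sf ?mem_head// ge_min db.
move=> j; rewrite inE => /predU1P[->|js]; first by rewrite ge_min lexx orbT.
by rewrite ge_min ds.
Qed.

(** The exponents of [e] and of its perturbations along the axes determine the
    coordinates of [y] as difference quotients; hence a point far from [y0] has
    one exponential far from its value at [y0]. *)
Lemma peak_outside (e y0 : 'rV[R]_n) (delta r : R) : 0 < delta -> 0 < r ->
  exists2 theta : R, 0 < theta < 1 & forall y,
    let xs := e :: [seq e + delta *: delta_mx 0 i | i <- enum 'I_n] in
    (forall x, x \in xs -> 0 <= dotrow y x /\ 0 <= dotrow y0 x) ->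
    r <= `|y - y0| -> peak xs y0 y <= theta.
Proof.
move=> d0 r0.
(* Two exponents known up to [eps] give a coordinate up to
   [2 * eps / delta = r / 2]. *)
set xs := _ :: _; pose eps := delta * r / 4.
have eps0 : 0 < eps by rewrite divr_gt0// mulr_gt0.
have sep0 : 0 < 1 - expR (- eps) by rewrite subr_gt0 expR_lt1 oppr_lt0.
have half0 : 0 < 2^-1 :> R by rewrite invr_gt0.
have [d /andP[dgt0 d12] dxs] := seq_positive_lower_bound half0
  (fun x (_ : x \in xs) => mulr_gt0 (expw_gt0 x y0) sep0).
have d2 : d ^+ 2 <= 2^-1 * 2^-1 by rewrite expr2 ler_pM// ltW.
have d20 : 0 < d ^+ 2 by rewrite exprn_gt0.
exists (1 - d ^+ 2); first by apply/andP; split; lra.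
move=> y /= xsP ry.
suff [x xxs xeps] : exists2 x, x \in xs & eps <= `|dotrow (y - y0) x|.
  apply: (peak_le (ltW dgt0) xsP xxs); apply: (le_trans (dxs x xxs)).
  exact: expw_separation.
apply: contrapT => /forall2NP H.
have {}H x : x \in xs -> `|dotrow (y - y0) x| < eps.
  by move=> xxs; have [//|/negP] := H x; rewrite -ltNge.
have : `|y - y0| < r.
  apply: rV_norm_lt => // i.
  have He := H e (mem_head _ _).
  have Hi : `|dotrow (y - y0) (e + delta *: delta_mx 0 i)| < eps.
    by apply: H; rewrite inE; apply/orP; right; apply/mapP; exists i => //; rewrite mem_enum.
  rewrite dotrowDr dotrowZr dotrow_delta in Hi.
  rewrite -(ltr_pM2l d0) -{1}[delta]gtr0_norm// -normrM.
  set a := dotrow _ e in He Hi; set b := delta * _ in Hi *.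
  have -> : b = (a + b) - a by rewrite addrAC subrr add0r.
  apply: le_lt_trans (ler_normB _ _) _.
  apply: lt_trans (ltrD Hi He) _; rewrite /eps.
  have : 0 < delta * r by rewrite mulr_gt0.
  by lra.
by rewrite ltNge ry.
Qed.

End ExponentialCombinations.

(** * Concentration against averaged difference quotients *)

Section PeakArgument.
Context d (T : measurableType d) (R : realType) (mu : {measure set T -> \bar R}).
Variables (V : normedModType R) (z0 : V) (rho r : R) (us vs : seq V) (k : nat).
Variables (G : V -> T -> R) (N : V -> set T) (w E : T -> R) (P : R).
Variables (q : V -> T -> R) (B B' : set T) (c eta0 theta1 theta2 kappa : R).
Hypotheses (rho0 : 0 < rho) (rhor : rho < r).
Hypotheses (usk : size us = k) (vsk : size vs = k).
Hypotheses (us1 : {in us, forall v, `|v| <= 1}) (vs1 : {in vs, forall v, `|v| <= 1}).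
Hypothesis G0 : forall z t, `|z - z0| < r -> 0 <= G z t.
Hypothesis NE : forall z, `|z - z0| < r -> [/\ measurable (N z), mu (N z) = 0%E &
  forall t, ~ N z t -> q z t = G z t].
Hypothesis w0 : forall t, 0 < w t.
Hypothesis E0 : forall t, 0 <= E t.
Hypothesis Gint : forall M z, `|z - z0| < r ->
  mu.-integrable setT (EFin \o (fun t => w t * E t ^+ M * G z t)).
Hypothesis GP : forall z, `|z - z0| < r -> \int[mu]_t (w t * G z t) <= P.
Hypothesis Gflat : forall M,
  flat us vs k z0 rho (fun z => \int[mu]_t (w t * E t ^+ M * G z t)).
Hypotheses (mB' : measurable B') (B'0 : (0 < mu B' < +oo)%E) (B'B : B' `<=` B).
Hypotheses (theta10 : 0 < theta1) (theta12 : theta1 < theta2) (kappa0 : 0 < kappa).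
Hypothesis Eout : forall z t, `|z - z0| < r -> ~ B t -> G z t != 0 -> E t <= theta1.
Hypothesis Ein : forall t, B' t -> theta2 <= E t /\ kappa <= w t.
Hypotheses (c0 : 0 < c) (eta00 : 0 < eta0).
Hypothesis qB : forall h z t, 0 < h -> h < eta0 -> `|z - z0| <= rho -> B t ->
  c * h ^+ k <= fdiff2 h us vs (fun z' => q z' t) z.

(** Applied to the kernels at a point [t] of [B], the averaging functional is at
    least [c]; at the other points, where [E] is at most [theta1], it is bounded
    by its mass. Integrated against [w * E ^+ M], it gives on the other hand the
    averaged difference quotients of flat functions, which are at most [eps] for
    a small step. *)
Lemma peak_bound M (h eps : R) : 0 < h -> h * (2 * k)%:R <= rho -> 0 < eps ->
  c * kappa * fine (mu B') * theta2 ^+ M <=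
    eps + theta1 ^+ M * (2 ^+ k.+1 / h ^+ k * P).
Proof.
move=> h0 hrho eps0.
have [h1 h10 flatM] := Gflat M eps0.
have [n n0 hn] : exists2 n : nat, (0 < n)%N & h / n%:R < Num.min h1 eta0.
  have m0 : 0 < Num.min h1 eta0 by rewrite lt_min h10.
  exists (Num.truncn (h / Num.min h1 eta0)).+1 => //.
  rewrite ltr_pdivrMr ?ltr0n// mulrC -ltr_pdivrMr//.
  by have /andP[] := truncn_itv (divr_ge0 (ltW h0) (ltW m0)).
have [hn1 hn2] : h / n%:R < h1 /\ h / n%:R < eta0.
  by move: hn; rewrite lt_min => /andP.
have hnpos : 0 < h / n%:R by rewrite divr_gt0// ltr0n.
have [l [lrho lB lE]] := averaging_functional z0 usk vsk us1 vs1 h0 n0.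
have lr p : p \in l -> `|p.2 - z0| < r.
  by move=> /lrho pz; rewrite (le_lt_trans pz)// (le_lt_trans hrho).
pose F z := \int[mu]_t (w t * E t ^+ M * G z t).
have lF : wsum l F <= eps.
  have : - eps <= wsum l (fun z => -1 * F z).
    apply: lE => z zr; rewrite /fdiff2 !fdiffsZ -mulrBr mulN1r mulNr lerN2.
    apply: le_trans (ler_norm _) _; apply: flatM => //.
    by rewrite (le_trans zr).
  rewrite /wsum; under eq_bigr do rewrite mulrCA.
  by rewrite -mulr_sumr mulN1r lerN2.
(* Outside [B], [H] is at least [- theta1 ^+ M * K]. *)
pose H t := \sum_(p <- l) p.1 * (w t * E t ^+ M * G p.2 t).
pose K t := \sum_(p <- l) `|p.1| * (w t * G p.2 t).
have [iH HE] : mu.-integrable setT (EFin \o H) /\ \int[mu]_t H t = wsum l F.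
  apply: (@integrable_wsum _ _ _ _ _ l fst (fun p t => w t * E t ^+ M * G p.2 t)) => p pl.
  exact: Gint (lr p pl).
have iG z : `|z - z0| < r -> mu.-integrable setT (EFin \o (fun t => w t * G z t)).
  by move=> /(Gint 0); apply: eq_integrable => // t _ /=; rewrite expr0 mulr1.
have [iK KE] : mu.-integrable setT (EFin \o K) /\
    \int[mu]_t K t = \sum_(p <- l) `|p.1| * \int[mu]_t (w t * G p.2 t).
  apply: (@integrable_wsum _ _ _ _ _ l (fun p => `|p.1|) (fun p t => w t * G p.2 t)) => p pl.
  exact: iG (lr p pl).
have P0 : 0 <= P.
  apply: le_trans (GP (_ : `|z0 - z0| < r)); last by rewrite subrr normr0 (lt_trans rho0).
  apply: Rintegral_ge0 => t _; rewrite mulr_ge0// ?G0 ?ltW// subrr normr0.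
  by rewrite (lt_trans rho0).
have KP : \int[mu]_t K t <= 2 ^+ k.+1 / h ^+ k * P.
  rewrite KE; apply: (@le_trans _ _ (\sum_(p <- l) `|p.1| * P)).
    rewrite big_seq [leRHS]big_seq; apply: ler_sum => p /lr pr.
    by rewrite ler_wpM2l// GP.
  by rewrite -mulr_suml ler_wpM2r.
have [N0 [mN0 N00 lN0]] := @null_seq_union _ _ _ mu _ l (fun p => N p.2) (fun p pl =>
  let: And3 a b _ := NE (lr p pl) in conj a b).
have theta20 : 0 < theta2 by rewrite (lt_trans theta10).
have pointwise t : ~ N0 t ->
    c * kappa * theta2 ^+ M * \1_B' t <= H t + theta1 ^+ M * K t.
  move=> N0t; have K0 : 0 <= K t.
    rewrite /K big_seq; apply: sumr_ge0 => p /lr pr.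
    by rewrite !mulr_ge0// ?G0 ?ltW.
  have [Bt|Bt] := pselect (B t).
    have HE' : H t = w t * E t ^+ M * wsum l (fun z => q z t).
      rewrite /H /wsum mulr_sumr big_seq [RHS]big_seq; apply: eq_bigr => p pl.
      have [_ _ ->] := NE (lr p pl); first by rewrite mulrCA.
      by move=> Npt; apply: N0t; exact: lN0 Npt.
    have lc : c <= wsum l (fun z => q z t).
      apply: lE => z zr; apply: qB => //; exact: le_trans hrho.
    have HH : w t * E t ^+ M * c <= H t.
      by rewrite HE' ler_wpM2l// mulr_ge0// ?exprn_ge0// ltW.
    apply: (@le_trans _ _ (H t)); last first.
      by rewrite lerDl mulr_ge0// exprn_ge0// ltW.
    apply: le_trans HH; rewrite indicE; have [B't|B't] := boolP (t \in B').
      have [Et wt] := Ein (set_mem B't).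
      rewrite mulr1 -mulrA mulrC ler_wpM2r ?(ltW c0)//.
      rewrite ler_pM ?exprn_ge0 ?(ltW kappa0) ?(ltW theta20)//.
      by rewrite lerXn2r ?nnegrE ?(ltW theta20).
    by rewrite mulr0 !mulr_ge0 ?exprn_ge0 ?(ltW (w0 t)) ?(ltW c0).
  have B't : ~ B' t by move=> /B'B.
  rewrite indicE memNset// mulr0 /H /K mulr_sumr -big_split/= big_seq.
  apply: sumr_ge0 => p /lr pr.
  rewrite [theta1 ^+ M * _]mulrCA.
  have [->|Gpt] := eqVneq (G p.2 t) 0; first by rewrite !mulr0 addr0.
  have : E t ^+ M <= theta1 ^+ M.
    by rewrite lerXn2r ?nnegrE ?(ltW theta10)//; exact: Eout Gpt.
  have wG : 0 <= w t * G p.2 t by rewrite mulr_ge0// ?G0 ?ltW.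
  move=> EM; rewrite -[w t * _ * _]mulrA [w t * _]mulrCA.
  have : `|p.1 * (E t ^+ M * (w t * G p.2 t))| <= `|p.1| * (theta1 ^+ M * (w t * G p.2 t)).
    rewrite normrM ler_wpM2l// ger0_norm ?ler_wpM2r// mulr_ge0// exprn_ge0//.
  by rewrite ler_norml => /andP[+ _]; rewrite -subr_ge0 opprK addrC.
have iB : mu.-integrable setT (EFin \o (\1_B' : T -> R)).
  apply/integrableP; split; first exact/measurable_EFinP/measurable_indic.
  rewrite (eq_integral (fun t => (\1_B' t)%:E)) => [|t _ /=]; last by rewrite ger0_norm.
  by rewrite integral_indic// setIT; case/andP: B'0.
have intB : \int[mu]_t (\1_B' t : R) = fine (mu B').
  by rewrite /Rintegral integral_indic// setIT.
have i1 := integrable_lin (theta1 ^+ M) iK.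
have := le_Rintegral_off_null mN0 N00 (integrable_lin (c * kappa * theta2 ^+ M) iB)
  (_ : mu.-integrable setT (EFin \o (fun t => H t + theta1 ^+ M * K t))) pointwise.
rewrite RintegralZl// intB RintegralD// RintegralZl// HE => main.
have : mu.-integrable setT (EFin \o (fun t => H t + theta1 ^+ M * K t)).
  have := integrableD measurableT iH i1; exact: eq_integrable.
move=> /main; rewrite -mulrA [theta2 ^+ M * _]mulrC mulrA => main'.
apply: (le_trans main'); apply: lerD => //.
by rewrite ler_wpM2l// exprn_ge0// ltW.
Qed.

Lemma peak_contradiction : False.
Proof.
have k0 : 0 < (2 * k).+1%:R :> R by rewrite ltr0n.
pose h := rho / (2 * k).+1%:R.
have h0 : 0 < h by rewrite divr_gt0.
have hrho : h * (2 * k)%:R <= rho.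
  by rewrite /h mulrAC ler_pdivrMr// ler_wpM2l ?(ltW rho0)// ler_nat.
have B'fin : 0 < fine (mu B').
  by apply: fine_gt0.
pose C1 := c * kappa * fine (mu B'); pose C2 := 2 ^+ k.+1 / h ^+ k * P.
have C10 : 0 < C1 by rewrite !mulr_gt0.
have theta20 : 0 < theta2 by rewrite (lt_trans theta10).
have bound M : C1 * theta2 ^+ M <= theta1 ^+ M * C2.
  apply/ler_addgt0Pl => eps eps0; exact: (peak_bound M h0 hrho eps0).
pose x := theta1 / theta2.
have x0 : 0 <= x by rewrite divr_ge0// ltW.
have x1 : `|x| < 1 by rewrite ger0_norm// /x ltr_pdivrMr// mul1r.
have := cvg_expr x1 => /cvgrPdist_lt/(_ (C1 / (`|C2| + 1))).
have C20 : 0 < `|C2| + 1 by rewrite ltr_wpDl.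
case; first by rewrite divr_gt0.
move=> M _ /(_ M (leqnn M)); rewrite sub0r normrN ger0_norm ?exprn_ge0//.
rewrite /x expr_div_n ltr_pdivrMr ?exprn_gt0// mulrAC ltr_pdivlMr// => H.
have := bound M; apply/negP; rewrite -ltNge; apply: le_lt_trans H.
rewrite ler_wpM2l ?exprn_ge0 ?(ltW theta10)//.
by rewrite (le_trans (ler_norm _))// lerDl.
Qed.
End PeakArgument.

(** * The toric equations *)

Section LaplaceFamily.
Variables (R : realType) (n m d : nat) (A : m.-tuple (multinom n)) (alpha : R).
Notation T := (n.-tuple (measurableTypeR R)).
Notation mu := (@lebesgue_tuple R n).
Variables (z0 : 'rV[R]_m) (rho r : R) (K : set 'rV[R]_n).
Variable (G : 'rV[R]_m -> T -> R).
Hypotheses (alpha0 : 0 < alpha) (rhor : rho < r).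
Hypothesis mG : forall z, `|z - z0| < r -> measurable_fun setT (G z).
Hypothesis G0 : forall z, `|z - z0| < r -> forall t, 0 <= G z t.
Hypothesis GK : forall z, `|z - z0| < r -> forall x, K x ->
  (\int[mu]_t (expw x (row_of_tuple t) * G z t)%:E =
    (coef_form A x z `^ (- alpha))%:E)%E.
Hypothesis Kpos : forall x, K x -> exists2 s0 : R, 0 < s0 &
  forall z, `|z - z0| < r -> s0 <= coef_form A x z.

(** An exponential integrates to a power of a linear form in [z], for which the
    toric relation makes the products of [flat_ridge] equal; the conclusion is
    linear. *)
Lemma exp_comb_laplace (u v : multinom m) phi : toric_relation A u v -> mdeg u = mdeg v ->
  exp_comb K phi ->
  (forall z, `|z - z0| < r ->
     mu.-integrable setT (EFin \o (fun t => phi (row_of_tuple t) * G z t))) /\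
  flat (directions R u) (directions R v) (mdeg u) z0 rho
    (fun z => \int[mu]_t (phi (row_of_tuple t) * G z t)).
Proof.
move=> uv duv; have u1 := @directions_norm R m u; have v1 := @directions_norm R m v.
have su := @size_directions R m u; have sv := @size_directions R m v.
rewrite -duv in sv.
elim=> [x Kx|f g _ [If Ff] _ [Ig Fg]|c f _ [If Ff]].
- split=> [z zr|].
    apply/integrableP; split.
      apply/measurable_EFinP/measurable_funM; last exact: mG.
      exact: measurable_exp_dotrow.
    rewrite (eq_integral (fun t => (expw x (row_of_tuple t) * G z t)%:E)) => [|t _ /=].
      by rewrite GK// ltry.
    by rewrite ger0_norm// mulr_ge0 ?(ltW (expw_gt0 _ _)) ?G0.
  have [s0 s00 Ks0] := Kpos Kx; have [M HM] := coef_form_bounded A x.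
  have na0 : - alpha <= 0 by rewrite oppr_le0 ltW.
  apply: (@eq_flat _ _ _ _ _ _ _ r (fun z => 1 * coef_form A x z `^ (- alpha))) => //.
    by move=> z zr; rewrite mul1r /Rintegral GK.
  apply: (@flat_ridge _ _ (coef_form A x) _ _ _ _ _ _ _ r 1 (- alpha) s0 M) => //.
  - exact: coef_formD.
  - exact: coef_formZ.
  - exact: toric_prod.
- split=> [z zr|].
    have := integrableD measurableT (If z zr) (Ig z zr).
    by apply: eq_integrable => // t _ /=; rewrite mulrDl EFinD.
  apply: (eq_flat rhor u1 v1 su sv _ (flatD Ff Fg)) => z zr.
  rewrite -RintegralD//; [|exact: If|exact: Ig].
  by apply: eq_Rintegral => t _; rewrite mulrDl.
- split=> [z zr|].
    have := integrable_lin c (If z zr).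
    by apply: eq_integrable => // t _ /=; rewrite mulrA.
  apply: (eq_flat rhor u1 v1 su sv _ (flatZ c Ff)) => z zr.
  rewrite -RintegralZl//; last exact: If.
  by apply: eq_Rintegral => t _; rewrite mulrA.
Qed.
End LaplaceFamily.

Section RieszFamily.
Variables (R : realType) (n m d : nat) (A : m.-tuple (multinom n)).
Variables (alpha : R) (e : 'rV[R]_n) (U : set 'rV[R]_m).
Variable (q : 'rV[R]_m -> 'rV[R]_n -> R).
Hypothesis fam : riesz_family A d alpha e U q.
Notation T := (n.-tuple (measurableTypeR R)).
Notation mu := (@lebesgue_tuple R n).

(** By homogeneity, positivity on a ball around [e] extends to the cone that it
    spans, which is connected. *)
Lemma cone_around_hyperbolicity z delta : 0 < delta ->
  (forall a, a \in tval A -> mdeg a = d) ->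
  (forall x, `|x - e| < delta -> 0 < coef_form A x z) ->
  (forall x, cone_around e delta x -> 0 < coef_form A x z) /\
  cone_around e delta `<=` hyperbolicity_cone (poly_of_coefs A z) e.
Proof.
move=> d0 Ad pos.
have pos' x : cone_around e delta x -> 0 < coef_form A x z.
  move=> [t t0 xt]; rewrite -[x](scalerKV (lt0r_neq0 t0)).
  rewrite (coef_form_homog _ _ _ Ad) mulr_gt0 ?exprn_gt0//; apply: pos.
  rewrite -[e](scalerK (lt0r_neq0 t0)) -scalerBr normrZ gtr0_norm ?invr_gt0//.
  by rewrite mulrC ltr_pdivrMr.
split=> //; apply: cone_around_connected_component => //.
by move=> x /pos'; rewrite /= /coef_form => /lt0r_neq0.
Qed.

(** A constant polynomial has no Riesz kernel in dimension at least one: its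
    hyperbolicity cone is the whole space, whose dual cone is a null set. *)
Lemma riesz_family_degree_gt0 z : U z -> (0 < d)%N.
Proof.
move=> Uz; have [n0 [_ Ad] a0 _ /(_ z Uz)[[_ pe _] _ qz]] := fam.
rewrite lt0n; apply/eqP => d0.
have const x : coef_form A x z = coef_form A e z.
  have H y : coef_form A (0 *: y) z = coef_form A y z.
    by rewrite (coef_form_homog z 0 y Ad) d0 expr0 mul1r.
  by rewrite -H scale0r -(scale0r e) H.
have Cfull x : hyperbolicity_cone (poly_of_coefs A z) e x.
  have d1 : 0 < `|x - e| + 1 by rewrite ltr_wpDl.
  have [_] := @cone_around_hyperbolicity z (`|x - e| + 1) d1 Ad
    (fun y _ => eq_ind_r (fun s => 0 < s) pe (const y)).
  by apply; apply: cone_around_ball; rewrite ltrDl.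
have [g [N [[mg mN N0] g0 gC _ gL]]] := riesz_kernel_borel qz.
have [mZ Z0] := lebesgue_tuple_origin R n0.
have gZ t : ~ (forall i, tnth t i = 0) -> g t = 0.
  move=> tZ; apply: gC => /(_ _ (Cfull (- row_of_tuple t))) H; apply: tZ => i.
  have : \sum_i (row_of_tuple t) 0 i ^+ 2 <= 0.
    rewrite -oppr_ge0 (_ : - _ = dotrow (row_of_tuple t) (- row_of_tuple t))//.
    by rewrite /dotrow -sumrN; apply: eq_bigr => j _; rewrite [(- row_of_tuple t) _ _]mxE mulrN.
  rewrite le_eqVlt ltNge sumr_ge0 ?orbF => [/eqP|j _]; last exact: sqr_ge0.
  move=> /psumr_eq0P => /(_ (fun j _ => sqr_ge0 _) i isT)/eqP.
  by rewrite sqrf_eq0 mxE => /eqP.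
have := gL e (Cfull e).
rewrite (ge0_negligible_integral mZ)//; last 2 first.
  by apply/measurable_EFinP/measurable_funM => //; exact: measurable_exp_dotrow.
  by move=> t _; rewrite lee_fin mulr_ge0// expR_ge0.
rewrite integral0_eq => [/eqP|t [_ /gZ ->]]; last by rewrite mulr0.
by rewrite eqe lt_eqF// /neg_power powR_gt0.
Qed.

End RieszFamily.

Section ToricEquation.
Variables (R : realType) (n m d : nat) (A : m.-tuple (multinom n)).
Variables (alpha : R) (e : 'rV[R]_n) (U : set 'rV[R]_m).
Variable (q : 'rV[R]_m -> 'rV[R]_n -> R).
Hypothesis fam : riesz_family A d alpha e U q.
Notation T := (n.-tuple (measurableTypeR R)).
Notation mu := (@lebesgue_tuple R n).
Variables (u v : multinom m) (W : set ('rV[R]_m * 'rV[R]_n)).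
Hypotheses (uv : toric_relation A u v) (oW : open W).
Hypothesis WU : forall z y, W (z, y) -> U z.
Hypothesis CW : class_C (maxn (mdeg u) (mdeg v)) W (fun w => q w.1 w.2).

(** By the mean value theorem both differences are iterated derivatives at points
    close to [z0], and these are continuous at [(z0, y0)]. *)
Lemma fdiff2_lower z0 y0 : mdeg u = mdeg v -> W (z0, y0) ->
  0 < toric_operator u v (fun z => q z y0) z0 ->
  exists r c : R, [/\ 0 < r, 0 < c & forall y h z, `|y - y0| < r -> 0 < h ->
    `|z - z0| + h * (mdeg u)%:R < r ->
    c * h ^+ mdeg u <=
      fdiff2 h (directions R u) (directions R v) (fun z' => q z' y) z].
Proof.
move=> duv W0; set c0 := toric_operator _ _ _ _ => c0gt0.
pose Q (w : 'rV[R]_m * 'rV[R]_n) := q w.1 w.2.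
pose D (s : multinom m) := iterD [seq (x, 0 : 'rV[R]_n) | x <- directions R s] Q.
have k4 : 0 < c0 / 4 by rewrite divr_gt0.
have DE s z y : D s (z, y) = partials s (fun z' => q z' y) z.
  by rewrite /D iterD_section partialsE.
have CQ s : (mdeg s <= maxn (mdeg u) (mdeg v))%N -> class_C (mdeg s) W Q.
  by move=> sm; exact: le_class_C sm CW.
have cont s : (mdeg s <= maxn (mdeg u) (mdeg v))%N ->
    \forall w \near (z0, y0), `|D s w - D s (z0, y0)| < c0 / 4.
  move=> sm; have : class_C 0 W (D s).
    by apply: class_C_iterD; rewrite size_map size_directions addn0; exact: CQ.
  move=> [/(_ _ W0) /cvgrPdist_lt/(_ _ k4) H _].
  by near=> w; rewrite distrC; near: w.
have chain s y : (mdeg s <= maxn (mdeg u) (mdeg v))%N ->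
    derive_chain [set z | W (z, y)] (directions R s) (fun z => q z y) (fun z => D s (z, y)).
  move=> sm; apply: (@derive_chain_section _ _ _ W _ Q); apply: class_C_derive_chain.
  by rewrite size_map size_directions; exact: CQ.
have near3 : \forall w \near (z0, y0), [/\ W w,
    `|D u w - D u (z0, y0)| < c0 / 4 & `|D v w - D v (z0, y0)| < c0 / 4].
  near=> w; split; near: w.
  - exact: open_nbhs_nbhs.
  - exact/cont/leq_maxl.
  - exact/cont/leq_maxr.
have [r r0 H] := (near_pairP z0 y0 _).1 near3.
exists r, (c0 / 2); split => //; first by rewrite divr_gt0.
move=> y h z yr h0 zr; have hk0 : 0 <= h ^+ mdeg u by rewrite exprn_ge0// ltW.
have mvt s : (mdeg s <= maxn (mdeg u) (mdeg v))%N -> mdeg s = mdeg u ->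
    exists2 z', `|z' - z0| < r & fdiffs h (directions R s) (fun z' => q z' y) z =
      h ^+ mdeg u * D s (z', y).
  move=> sm su; have := @fdiffs_mvt _ _ h (directions R s) (fun z' => q z' y)
    (fun z' => D s (z', y)) z0 r z h0 (@directions_norm R m s).
  rewrite size_directions su => /(_ _ zr)[].
    apply: sub_derive_chain (chain s y sm) => z' /= z'r.
    by have [] := H z' y z'r yr.
  move=> z' z'z ->; exists z' => //; apply: le_lt_trans zr.
  rewrite -(subrK z z') -addrA addrC (le_trans (ler_normD _ _))//.
  by rewrite lerD2l.
have [z1 z1r E1] := mvt u (leq_maxl _ _) erefl.
have [z2 z2r E2] := mvt v (leq_maxr _ _) (esym duv).
rewrite /fdiff2 E1 E2 -mulrBr mulrC ler_wpM2l//.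
have [_ H1 _] := H z1 y z1r yr; have [_ _ H2] := H z2 y z2r yr.
move: H1 H2; rewrite !ltr_norml => /andP[H1 _] /andP[_ H2].
have : c0 = D u (z0, y0) - D v (z0, y0) by rewrite !DE.
by lra.
Unshelve. all: by end_near. Qed.

(** If the toric operator is positive at [(z0, y0)], then [y0] is nonnegative on
    the common cone [K], since otherwise all the kernels vanish at [y0]; the
    peak at [y0] then leads to a contradiction. *)
Lemma toric_operator_le0 z0 y0 : W (z0, y0) ->
  toric_operator u v (fun z => q z y0) z0 <= 0.
Proof.
move=> W0; have Uz0 := WU W0; have d0 := riesz_family_degree_gt0 fam Uz0.
have [n0 [_ Ad] alpha0 oU Ufam] := fam.
have duv := toric_mdeg d0 Ad uv.
rewrite leNgt; apply/negP => /(fdiff2_lower duv W0)[r1 [c [r10 c0 r1P]]].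
have [_ pe0 _] := let: And3 a _ _ := Ufam z0 Uz0 in a.
have near_pos : \forall w \near (z0, e), 0 < coef_form A w.2 w.1.
  by have /cvgr_gt := @continuous_coef_form R n m A (z0, e); exact.
have [r2 r20 r2P] := (near_pairP z0 e _).1 near_pos.
have [r3 r30 r3P] : exists2 r3 : R, 0 < r3 & forall z, `|z - z0| < r3 -> U z.
  have /nbhs_ballP[r3 r30 H] : nbhs z0 U by exact: open_nbhs_nbhs.
  by exists r3 => // z zr; apply: H; rewrite -ball_normE/= distrC.
pose r := Num.min (Num.min r1 (r2 / 2)) r3.
have r0 : 0 < r by rewrite !lt_min r10 r30 divr_gt0.
have rr1 : r <= r1 by rewrite !ge_min lexx.
have rr2 : r <= r2 / 2 by rewrite !ge_min lexx orbT.
have rr3 : r <= r3 by rewrite !ge_min lexx !orbT.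
pose K := cone_around e r.
have conez z : `|z - z0| < r2 -> (forall x, K x -> 0 < coef_form A x z) /\
    K `<=` hyperbolicity_cone (poly_of_coefs A z) e.
  move=> zr; apply: (cone_around_hyperbolicity r0 Ad) => x xr; apply: r2P => //.
  by rewrite (lt_le_trans xr)// (le_trans rr2)// ler_pdivrMr// ler_peMr ?ltW// ltr1n.
have rlt2 z : `|z - z0| < r -> `|z - z0| < r2.
  by move=> zr; rewrite (lt_le_trans zr)// (le_trans rr2)// ler_pdivrMr// ler_peMr ?ltW// ltr1n.
have zz0 : `|z0 - z0| < r2 by rewrite subrr normr0.
(* [z] is the midpoint of [z0] and of [2 *: z - z0], where the form is still
   positive because [r <= r2 / 2]; this makes the lower bound uniform in [z]. *)
have Khalf x z : K x -> `|z - z0| < r -> coef_form A x z0 / 2 <= coef_form A x z.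
  move=> Kx zr; have : 0 < coef_form A x (2 *: z - z0).
    apply: (conez _ _).1 => //.
    have -> : 2 *: z - z0 - z0 = 2 *: (z - z0).
      by rewrite scalerBr -addrA -opprD -[z0 + z0]mulr2n -[z0 *+ 2]scaler_nat.
    rewrite normrZ ger0_norm// mulrC -ltr_pdivlMr//; exact: lt_le_trans rr2.
  rewrite -[- z0]scaleN1r coef_formD !coef_formZ; lra.
have Kpos x : K x -> exists2 s0 : R, 0 < s0 &
    forall z, `|z - z0| < r -> s0 <= coef_form A x z.
  move=> Kx; exists (coef_form A x z0 / 2); last by move=> z; exact: Khalf.
  by rewrite divr_gt0//; exact: (conez z0 zz0).1.
have : forall z, exists gN : (T -> R) * set T, `|z - z0| < r -> [/\
    [/\ measurable_fun setT gN.1, measurable gN.2 & mu gN.2 = 0%E],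
    forall t, 0 <= gN.1 t,
    forall t x, gN.1 t != 0 -> K x -> 0 <= dotrow (row_of_tuple t) x,
    forall t, ~ gN.2 t -> q z (row_of_tuple t) = gN.1 t &
    forall x, K x -> (\int[mu]_t (expw x (row_of_tuple t) * gN.1 t)%:E =
      (coef_form A x z `^ (- alpha))%:E)%E].
  move=> z; have [zr|zr] := pselect (`|z - z0| < r); last first.
    by exists (fun=> 0, set0).
  have [_ _ qz] := Ufam z (r3P _ (lt_le_trans zr rr3)).
  have [g [N [gN g0 gC gq gL]]] := riesz_kernel_borel qz.
  have [_ KC] := conez z (rlt2 z zr).
  exists (g, N) => _; split => //= [t x gt Kx|x /KC]; last exact: gL.
  have : dual_cone (hyperbolicity_cone (poly_of_coefs A z) e) (row_of_tuple t).
    by apply: contrapT => /gC/eqP; rewrite (negbTE gt).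
  by apply; exact: KC.
move=> /choice[gN gNP].
pose G z := (gN z).1; pose N z := (gN z).2.
have Ke : K e by apply: cone_around_ball; rewrite // subrr normr0.
pose rho := r / 2; have rho0 : 0 < rho by rewrite divr_gt0.
have rhor : rho < r by rewrite /rho; lra.
have k0 : 0 < (mdeg u).+1%:R :> R by rewrite ltr0n.
pose eta0 := (r - rho) / (mdeg u).+1%:R.
have eta00 : 0 < eta0 by rewrite divr_gt0// subr_gt0.
have qB h z y : 0 < h -> h < eta0 -> `|z - z0| <= rho -> `|y - y0| < r ->
    c * h ^+ mdeg u <= fdiff2 h (directions R u) (directions R v) (fun z' => q z' y) z.
  move=> h0 heta zr yr; apply: r1P => //; first exact: lt_le_trans rr1.
  apply: lt_le_trans rr1; move: heta; rewrite ltr_pdivlMr// -natr1 mulrDr mulr1; lra.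
have [y0K|y0K] := pselect (forall x, K x -> 0 <= dotrow y0 x); last first.
  have q0 z : `|z - z0| < r -> q z y0 = 0.
    move=> zr; have [_ _ [_ qC _ _]] := Ufam z (r3P _ (lt_le_trans zr rr3)).
    by apply: qC => H; apply: y0K => x Kx; apply: H; exact: (conez z (rlt2 z zr)).2.
  have h0 : 0 < eta0 / 2 by rewrite divr_gt0.
  have := qB (eta0 / 2) z0 y0 h0; rewrite !subrr !normr0 => /(_ _ (ltW rho0) r0).
  have zero s : mdeg s = mdeg u ->
      fdiffs (eta0 / 2) (directions R s) (fun z' => q z' y0) z0 = 0.
    move=> su; rewrite (@eq_fdiffs _ _ _ _ _ (fun z => 0 * 0)) ?ltW//; first by rewrite fdiffsZ mul0r.
    - exact: directions_norm.
    - move=> z; rewrite size_directions su => zr; rewrite mul0r; apply: q0.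
      apply: (le_lt_trans zr); apply: (@le_lt_trans _ _ (eta0 * (mdeg u)%:R)).
        by rewrite ler_wpM2r//; lra.
      rewrite /eta0 mulrAC ltr_pdivrMr// -natr1; nra.
  rewrite /fdiff2 !zero// subrr => H.
  have : c * (eta0 / 2) ^+ mdeg u <= 0 by apply: H; lra.
  by rewrite leNgt mulr_gt0// exprn_gt0.
pose delta := r / 2; have delta0 : 0 < delta by rewrite divr_gt0.
have [theta1 /andP[th0 th1] out] := peak_outside e y0 delta0 r0.
set xs := _ :: _ in out.
have xsK x : x \in xs -> K x.
  rewrite inE => /predU1P[->//|/mapP[i _ ->]]; apply: cone_around_ball => //.
  rewrite addrAC subrr add0r normrZ gtr0_norm// (@le_lt_trans _ _ delta)//.
  by rewrite ler_piMr ?(ltW delta0) ?rV_norm_delta.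
pose theta2 : R := (theta1 + 1) / 2.
have th12 : theta1 < theta2 by rewrite /theta2 midf_lt.
have [r' r'0 r'P] : exists2 r' : R, 0 < r' & forall y, `|y - y0| < r' ->
    theta2 <= peak xs y0 y /\ expw e y0 / 2 <= expw e y.
  have ph : theta2 < peak xs y0 y0 by rewrite peak_center /theta2 midf_lt.
  have eh : expw e y0 / 2 < expw e y0.
    by rewrite ltr_pdivrMr// ltr_pMr ?expw_gt0// ltr1n.
  have H1 : \forall y \near y0, theta2 < peak xs y0 y.
    by have /cvgr_gt := @continuous_peak R n xs y0 y0; exact.
  have H2 : \forall y \near y0, expw e y0 / 2 < expw e y.
    by have /cvgr_gt := @continuous_expw R n e y0; exact.
  have /nbhs_ballP[r' r'0 H] : \forall y \near y0, theta2 < peak xs y0 y /\ expw e y0 / 2 < expw e y.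
    by near=> y; split; near: y.
  exists r' => // y yr; have [|/ltW ? /ltW //] := H y.
  by rewrite -ball_normE/= distrC.
pose s := Num.min r r'; have s0 : 0 < s by rewrite lt_min r0.
have box t : tuple_box (fun i => y0 0 i) s t -> `|row_of_tuple t - y0| < s.
  by move=> ts; apply: rV_norm_lt => // i; rewrite !mxE; exact: ts.
have lap phi : exp_comb K phi -> _ := exp_comb_laplace alpha0 rhor
  (fun z zr => let: And5 (And3 a _ _) _ _ _ _ := gNP z zr in a)
  (fun z zr => let: And5 _ a _ _ _ := gNP z zr in a)
  (fun z zr => let: And5 _ _ _ _ a := gNP z zr in a) Kpos uv duv.
have peakX M := exp_comb_peakX y0 M (@cone_aroundD R n e r) xsK Ke.
have P0 : 0 < (coef_form A e z0 / 2) by rewrite divr_gt0.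
apply: (@peak_contradiction _ T R mu _ z0 rho r (directions R u) (directions R v)
  (mdeg u) G N (fun t => expw e (row_of_tuple t)) (fun t => peak xs y0 (row_of_tuple t))
  ((coef_form A e z0 / 2) `^ (- alpha)) (fun z t => q z (row_of_tuple t))
  [set t | `|row_of_tuple t - y0| < r] (tuple_box (fun i => y0 0 i) s)
  c eta0 theta1 theta2 (expw e y0 / 2)) => //.
- exact: size_directions.
- by rewrite size_directions.
- exact: directions_norm.
- exact: directions_norm.
- by move=> z t zr; have [_ + _ _ _] := gNP z zr; apply.
- by move=> z zr; have [[_ ? ?] _ _ ? _] := gNP z zr; split.
- by move=> t; exact: expw_gt0.
- by move=> t; exact: peak_ge0.
- by move=> M z zr; have [+ _] := lap _ (peakX M); apply.
- move=> z zr; have [_ _ _ _ gL] := gNP z zr.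
  rewrite /Rintegral gL//= !powRN lef_pV2 ?posrE ?powR_gt0//; last first.
    by apply: (lt_le_trans P0); exact: Khalf.
  rewrite ge0_ler_powR ?nnegrE ?(ltW alpha0) ?(ltW P0)//; last exact: Khalf.
  by rewrite (le_trans (ltW P0))//; exact: Khalf.
- by move=> M; have [_] := lap _ (peakX M).
- exact: measurable_tuple_box.
- apply/andP; split; [rewrite [ltRHS](lebesgue_tuple_box _ s0) | rewrite [ltLHS](lebesgue_tuple_box _ s0)].
    by rewrite lte_fin exprn_gt0// mulrn_wgt0.
  exact: ltry.
- by move=> t /box /= ts; rewrite (lt_le_trans ts)// ge_min lexx.
- by rewrite divr_gt0// expw_gt0.
- move=> z t zr tB gt; have [_ _ gK _ _] := gNP z zr.
  apply: out; last by rewrite leNgt; exact/negP.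
  by move=> x /xsK Kx; split; [exact: gK gt Kx | exact: y0K].
- by move=> t /box ts; apply: r'P; rewrite (lt_le_trans ts)// ge_min lexx orbT.
- by move=> h z t h0 heta zr /= tB; exact: qB.
Unshelve. all: by end_near. Qed.

End ToricEquation.

(** * Algebra of functions of class C^k *)

Section ClassCAlgebra.
Variables (R : realType) (V : normedModType R) (W : set V).
Hypothesis oW : open W.
Implicit Types f g : V -> R.

Lemma class_C_ext k f g : (forall x, W x -> f x = g x) -> class_C k W f -> class_C k W g.
Proof.
have near_ext f' g' x : (forall y, W y -> f' y = g' y) -> W x -> \forall y \near x, f' y = g' y.
  by move=> fg Wx; have := open_nbhs_nbhs (conj oW Wx); apply: filterS => y; exact: fg.
have cont f' g' x : (forall y, W y -> f' y = g' y) -> W x ->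
    {for x, continuous f'} -> {for x, continuous g'}.
  move=> fg Wx cf; have : g' @ x --> f' x.
    by apply: cvg_trans cf; apply: near_eq_cvg; exact: near_ext.
  by rewrite (fg x Wx).
elim: k f g => [|k IH] f g fg [cf df]; split => //.
- by move=> x Wx; exact: (cont _ _ _ fg Wx (cf x Wx)).
- by move=> x Wx; exact: (cont _ _ _ fg Wx (cf x Wx)).
move=> v; have [dv Cv] := df v; split.
  by move=> x Wx; apply: near_eq_derivable (dv x Wx); exact: near_ext.
by apply: IH Cv => x Wx; apply: near_eq_derive; exact: near_ext.
Qed.

(** The candidate derivatives only have to be correct on the open set [W]. *)
Lemma class_C_intro k f (df : V -> V -> R) :
  (forall x, W x -> {for x, continuous f}) ->
  (forall v x, W x -> is_derive x v f (df v x)) ->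
  (forall v, class_C k W (df v)) -> class_C k.+1 W f.
Proof.
move=> cf dfP Cdf; split=> // v; split; first by move=> x /(dfP v) [].
apply: class_C_ext (Cdf v) => x Wx.
by have Hd := dfP v x Wx; rewrite (@derive_val _ _ _ _ _ _ _ Hd).
Qed.

Lemma class_C_continuous k f x : class_C k W f -> W x -> {for x, continuous f}.
Proof. by case: k => [|k] [cf _]; exact: cf. Qed.

Lemma class_C_is_derive k f v x : class_C k.+1 W f -> W x -> is_derive x v f ('D_v f x).
Proof. by move=> [_ /(_ v)[df _]] Wx; exact/derivableP/df. Qed.

Lemma class_C_cst k c : class_C k W (fun=> c).
Proof.
elim: k c => [|k IH] c; first by split=> // x _; exact: cst_continuous.
have c1 x : W x -> {for x, continuous (fun=> c : R)} by move=> _; exact: cst_continuous.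
have c2 v x : W x -> is_derive x v (fun=> c : R) 0 by move=> _; exact: is_derive_cst.
exact (class_C_intro c1 c2 (fun=> IH 0)).
Qed.

Lemma class_CD k f g : class_C k W f -> class_C k W g -> class_C k W (fun x => f x + g x).
Proof.
elim: k f g => [|k IH] f g Cf Cg.
  by split=> // x Wx; apply: continuousD; [exact: class_C_continuous Cf Wx|exact: class_C_continuous Cg Wx].
apply: (@class_C_intro _ _ (fun v x => 'D_v f x + 'D_v g x)).
- by move=> x Wx; apply: continuousD; [exact: class_C_continuous Cf Wx|exact: class_C_continuous Cg Wx].
- move=> v x Wx; have df := class_C_is_derive v Cf Wx; have dg := class_C_is_derive v Cg Wx.
  exact: is_deriveD.
- by move=> v; apply: IH; [have [_ /(_ v)[]] := Cf | have [_ /(_ v)[]] := Cg].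
Qed.

Lemma class_CM k f g : class_C k W f -> class_C k W g -> class_C k W (fun x => f x * g x).
Proof.
elim: k f g => [|k IH] f g Cf Cg.
  by split=> // x Wx; apply: continuousM; [exact: class_C_continuous Cf Wx|exact: class_C_continuous Cg Wx].
apply: (@class_C_intro _ _ (fun v x => f x * 'D_v g x + g x * 'D_v f x)).
- by move=> x Wx; apply: continuousM; [exact: class_C_continuous Cf Wx|exact: class_C_continuous Cg Wx].
- move=> v x Wx; have df := class_C_is_derive v Cf Wx; have dg := class_C_is_derive v Cg Wx.
  exact: is_deriveM.
- move=> v; have [_ /(_ v)[_ Df]] := Cf; have [_ /(_ v)[_ Dg]] := Cg.
  by apply: class_CD; apply: IH => //; exact: class_CW.
Qed.

Lemma is_derive_inv f v x d : f x != 0 -> is_derive x v f d ->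
  is_derive x v (fun y => (f y)^-1) (- (f x) ^- 2 * d).
Proof.
move=> fx [df <-]; split; first exact: derivableV.
by rewrite deriveV.
Qed.

Lemma class_CV k f : (forall x, W x -> f x != 0) -> class_C k W f ->
  class_C k W (fun x => (f x)^-1).
Proof.
move=> f0; have cV j x : class_C j W f -> W x -> {for x, continuous (fun x => (f x)^-1)}.
  by move=> Cf Wx; apply: cvgV; [exact: f0 | exact: class_C_continuous Cf Wx].
elim: k => [|k IH] Cf; first by split=> // x Wx; exact: cV Cf Wx.
apply: (@class_C_intro _ _ (fun v x => -1 * ((f x)^-1 * (f x)^-1 * 'D_v f x))).
- by move=> x Wx; exact: cV Cf Wx.
- move=> v x Wx; have df := class_C_is_derive v Cf Wx.
  apply: is_derive_eq (is_derive_inv (f0 x Wx) df) _.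
  by rewrite expr2 invfM mulN1r mulNr.
- move=> v; have [_ /(_ v)[_ Df]] := Cf; have Cfk := class_CW Cf.
  apply: class_CM; first exact: class_C_cst.
  by apply: class_CM => //; apply: class_CM; exact: IH.
Qed.

Lemma is_derive_linear f v x : (forall x y, f (x + y) = f x + f y) ->
  (forall t x, f (t *: x) = t * f x) -> is_derive x v f (f v).
Proof.
move=> fD fZ.
have H : (fun h => h^-1 *: ((f \o shift x) (h *: v) - f x)) @ 0^' --> f v.
  have c : (fun _ : R => f v) @ 0^' --> f v by exact: cvg_cst.
  apply: cvg_trans c; apply: near_eq_cvg.
  near=> h; rewrite /= fD fZ addrK [_ *: _]mulrA mulVf ?mul1r//.
  by near: h; exact: nbhs_dnbhs_neq.
by split; [apply/cvg_ex; exists (f v) | exact: cvg_lim H].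
Unshelve. all: by end_near. Qed.

Lemma class_C_linear k f : (forall x y, f (x + y) = f x + f y) ->
  (forall t x, f (t *: x) = t * f x) -> continuous f -> class_C k W f.
Proof.
move=> fD fZ cf; case: k => [|k]; first by split=> // x _; exact: cf.
apply: (@class_C_intro _ _ (fun v _ => f v)) => [x _|v x _|v].
- exact: cf.
- exact: is_derive_linear.
- exact: class_C_cst.
Qed.
End ClassCAlgebra.

(** * A family of products of two linear forms in two variables *)

Section Example.
Variable R : realType.
Notation i0 := (ord0 : 'I_2).
Notation i1 := (lift ord0 ord0 : 'I_2).
Implicit Types (z x y : 'rV[R]_2).

(** The monomials x_1^2 and x_1 x_2. *)
Definition quad_exps : 2.-tuple (multinom 2) :=
  [tuple Multinom [tuple 2%N; 0%N]; Multinom [tuple 1%N; 1%N]].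
Notation A := quad_exps.

Lemma quad_expsE : (tnth A i0 i0 = 2%N) * (tnth A i0 i1 = 0%N) *
  (tnth A i1 i0 = 1%N) * (tnth A i1 i1 = 1%N).
Proof. by []. Qed.

Definition quad_e : 'rV[R]_2 := delta_mx 0 i0.
Notation e := quad_e.
Definition quad_U : set 'rV[R]_2 := [set z : 'rV[R]_2 | 0 < z 0 i0 /\ 0 < z 0 i1].
Definition second_factor z x : R := z 0 i0 * x 0 i0 + z 0 i1 * x 0 i1.
Notation p z := (poly_of_coefs A z).

Lemma quad_eval z x : mpoly_eval (p z) x = x 0 i0 * second_factor z x.
Proof.
rewrite poly_of_coefs_eval big_ord_recl big_ord1 /mono_eval.
rewrite !big_ord_recl !big_ord0 /=.
rewrite /second_factor.
by rewrite !quad_expsE; ring.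
Qed.

Definition quad_cone z : set 'rV[R]_2 := [set x : 'rV[R]_2 | 0 < x 0 i0 /\ 0 < second_factor z x].

Lemma quad_e0 : e 0 i0 = 1. Proof. by rewrite mxE. Qed.
Lemma quad_e1 : e 0 i1 = 0. Proof. by rewrite mxE. Qed.

Lemma second_factorD z x y : second_factor z (x + y) = second_factor z x + second_factor z y.
Proof. by rewrite /second_factor !mxE; ring. Qed.

Lemma second_factorZ z t x : second_factor z (t *: x) = t * second_factor z x.
Proof. by rewrite /second_factor !mxE; ring. Qed.

Lemma continuous_coord (i : 'I_2) : continuous (fun x : 'rV[R]_2 => x 0 i).
Proof. exact: coord_continuous. Qed.

Lemma continuous_second_factor z : continuous (second_factor z).
Proof.
move=> x; have c (i : 'I_2) : {for x, continuous (fun y : 'rV[R]_2 => z 0 i * y 0 i)}.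
  apply: continuousM; first exact: cst_continuous.
  exact: continuous_coord.
exact: continuousD (c i0) (c i1).
Qed.

Lemma quad_cone_e z : quad_U z -> quad_cone z e.
Proof. by move=> [z0 z1]; split; rewrite /second_factor ?quad_e0 ?quad_e1// mulr1 mulr0 addr0. Qed.

Lemma quad_hyperbolicity_cone z : quad_U z -> hyperbolicity_cone (p z) e = quad_cone z.
Proof.
move=> Uz; have [e0 el] := quad_cone_e Uz.
apply/seteqP; split=> x; rewrite /hyperbolicity_cone; last first.
  move=> [x0 xl]; apply: segment_connected_component => s s0 s1 /=; rewrite quad_eval.
  have [->|s1'] := eqVneq s 1.
    by rewrite subrr scale0r add0r scale1r mulf_neq0 ?gt_eqF.
  have s1'' : 0 < 1 - s by rewrite subr_gt0 lt_neqAle s1'.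
  rewrite second_factorD !second_factorZ !mxE mulf_neq0// gt_eqF//.
    by rewrite ltr_pwDl ?mulr_gt0 ?mulr_ge0// ltW.
  by rewrite ltr_pwDl ?mulr_gt0 ?mulr_ge0// ltW.
move=> cx; have px0 y : [set x : 'rV[R]_2 | mpoly_eval (p z) x != 0] y -> y 0 i0 != 0 /\ second_factor z y != 0.
  by rewrite /= quad_eval mulf_eq0 negb_or => /andP.
split.
- by apply: (connected_component_pos (@continuous_coord i0) _ e0 cx) => y /px0[].
- by apply: (connected_component_pos (@continuous_second_factor z) _ el cx) => y /px0[].
Qed.

Lemma quad_hyperbolic z : quad_U z -> hyperbolic (p z) e.
Proof.
move=> Uz; have [e0 el] := quad_cone_e Uz; have [z0 z1] := Uz; split.
- exists 2%N; rewrite /poly_of_coefs; apply: rpred_sum => j _; apply: dhomogZ.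
  rewrite dhomogX; apply/eqP; have [->|->] : tnth A j = tnth A i0 \/ tnth A j = tnth A i1.
      case: (unliftP ord0 j) => [k ->|->]; [right|by left].
      by rewrite ord1.
    by apply: etrans (mdegE _) _; rewrite !big_ord_recl big_ord0.
  by apply: etrans (mdegE _) _; rewrite !big_ord_recl big_ord0.
- by rewrite quad_eval mulr_gt0.
move=> x w.
have -> : line_restriction (p z) e x =
    ('X - (x 0 i0)%:P) * ((z 0 i0) *: 'X - (second_factor z x)%:P).
  rewrite /line_restriction /poly_of_coefs raddf_sum/= big_ord_recl big_ord1 !mmapZ !mmapX.
  rewrite /mmap1 !big_ord_recl !big_ord0 quad_e0 quad_e1 scale1r scale0r.
  rewrite -[_ *: 'X]mul_polyC !quad_expsE /second_factor rmorphD !rmorphM /= !expr1 expr0.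
  by ring.
rewrite rmorphM/= !rmorphB/= map_polyX !map_polyC/= map_polyZ map_polyX/=.
rewrite rootM root_XsubC => /orP[/eqP->//|].
rewrite /root !hornerE subr_eq0 => /eqP zw.
have zc : (z 0 i0)%:C%C != 0 by rewrite (inj_eq (@complexI R)) gt_eqF.
have -> : w = (second_factor z x / z 0 i0)%:C%C.
  by rewrite rmorphM/= fmorphV -zw mulrAC mulfV// mul1r.
by [].
Qed.
End Example.

Section ProductsOfNegativePowers.
Variables (R : realType) (V : normedModType R) (X L : V -> R) (C : set V).
Hypotheses (XD : forall x y, X (x + y) = X x + X y) (XZ : forall t x, X (t *: x) = t * X x).
Hypotheses (LD : forall x y, L (x + y) = L x + L y) (LZ : forall t x, L (t *: x) = t * L x).
Hypothesis oC : open C.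
Hypotheses (X0 : forall x, C x -> 0 < X x) (L0 : forall x, C x -> 0 < L x).

(** The constant 1 in front of the second power puts both factors of a monomial
    in the form c lin^a of [is_derive_ridge]. *)
Inductive neg_powers : (V -> R) -> Prop :=
| neg_powers_monomial (c a b : R) : 0 <= c -> 0 <= a -> 0 <= b ->
    neg_powers (fun x => c * X x `^ (- a) * (1 * L x `^ (- b)))
| neg_powersD f g : neg_powers f -> neg_powers g -> neg_powers (fun x => f x + g x).

Lemma neg_powers_ge0 f x : neg_powers f -> 0 <= f x.
Proof.
elim=> [c a b c0 _ _|f' g' _ IHf _ IHg]; last exact: addr_ge0.
by rewrite !mulr_ge0 ?powR_ge0.
Qed.

Lemma neg_powers_derive v f : C v -> neg_powers f ->
  exists2 g, neg_powers g & forall x, C x -> is_derive x v f (- g x).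
Proof.
move=> Cv; elim=> [c a b c0 a0 b0|f1 f2 _ [g1 Pg1 d1] _ [g2 Pg2 d2]]; last first.
  exists (fun x => g1 x + g2 x); first exact: neg_powersD.
  move=> x Cx; rewrite opprD; have e1 := d1 x Cx; have e2 := d2 x Cx.
  exact: is_deriveD.
have Xv := ltW (X0 Cv); have Lv := ltW (L0 Cv).
exists (fun x => (c * a * X v) * X x `^ (- (a + 1)) * (1 * L x `^ (- b)) +
                 (c * b * L v) * X x `^ (- a) * (1 * L x `^ (- (b + 1)))).
  by apply: neg_powersD; apply: neg_powers_monomial; rewrite ?mulr_ge0// addr_ge0.
move=> x Cx.
have e1 := is_derive_ridge XD XZ c (- a) v (X0 Cx).
have e2 := is_derive_ridge LD LZ 1 (- b) v (L0 Cx).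
apply: is_derive_eq (is_deriveM e1 e2) _.
rewrite /GRing.scale/= !opprD; ring.
Qed.

(** Each differentiation in a direction on which both linear forms are positive
    costs one sign and keeps all coefficients nonnegative. *)
Lemma neg_powers_alternating f f0 vs : neg_powers f -> (forall x, C x -> f0 x = f x) ->
  (forall v, v \in vs -> C v) ->
  exists2 g, neg_powers g &
    forall x, C x -> foldr (fun v h => 'D_v h) f0 vs x = (-1) ^+ size vs * g x.
Proof.
move=> Pf f0f; elim: vs => [|v vs IH] Cvs.
  by exists f => // x Cx; rewrite expr0 mul1r; exact: f0f.
have [g Pg gE] := IH (fun w wvs => Cvs w (mem_behead (wvs : w \in behead (v :: vs)))).
have Cv : C v by apply: Cvs; rewrite mem_head.
have [g' Pg' dg] := neg_powers_derive Cv Pg; exists g' => // x Cx /=.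
rewrite (near_eq_derive (g := fun y => (-1) ^+ size vs * g y)); last first.
  by have := open_nbhs_nbhs (conj oC Cx); apply: filterS => y; exact: gE.
have e1 := dg x Cx; have e2 := is_deriveZ ((-1) ^+ size vs) e1.
rewrite [LHS](@derive_val _ _ _ _ _ _ _ e2).
by rewrite exprS -mulrA mulN1r -mulrN.
Qed.
End ProductsOfNegativePowers.

Section ExampleMonotone.
Variable R : realType.
Notation i0 := (ord0 : 'I_2).
Notation i1 := (lift ord0 ord0 : 'I_2).
Implicit Types (z x y : 'rV[R]_2).
Notation A := quad_exps.
Notation p z := (poly_of_coefs A z).

Lemma open_quad_cone z : open (quad_cone z).
Proof.
apply: openI.
- apply: (@open_comp _ _ (fun x : 'rV[R]_2 => x 0 i0) [set t | 0 < t]); last exact: open_gt.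
  by move=> x _; exact: continuous_coord.
- apply: (@open_comp _ _ (second_factor z) [set t | 0 < t]); last exact: open_gt.
  by move=> x _; exact: continuous_second_factor.
Qed.

Lemma quad_neg_power z x : quad_cone z x ->
  neg_power (p z) 2 x = (x 0 i0 * second_factor z x) ^- 2.
Proof.
by move=> [x0 xl]; rewrite /neg_power quad_eval powRN powR_mulrn ?mulr_ge0// ltW.
Qed.

Lemma quad_completely_monotone z : completely_monotone (quad_cone z) (neg_power (p z) 2).
Proof.
have oC := @open_quad_cone z; split=> [k|vs x Cvs Cx].
  have linX : class_C k (quad_cone z) (fun x : 'rV[R]_2 => x 0 i0).
    by apply: (class_C_linear oC) => [x y|t x|]; [rewrite mxE|rewrite mxE|exact: continuous_coord].
  have linL : class_C k (quad_cone z) (second_factor z).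
    apply: (class_C_linear oC); [exact: second_factorD|exact: second_factorZ|].
    exact: continuous_second_factor.
  have inv := class_CV oC (fun x (Cx : quad_cone z x) => lt0r_neq0 (mulr_gt0 Cx.1 Cx.2))
    (class_CM oC linX linL).
  apply: (class_C_ext oC _ (class_CM oC inv inv)) => x Cx.
  by rewrite quad_neg_power// -exprVn expr2.
have P0 : neg_powers (fun x : 'rV[R]_2 => x 0 i0) (second_factor z)
    (fun x => 1 * x 0 i0 `^ (- 2) * (1 * second_factor z x `^ (- 2))).
  exact: neg_powers_monomial.
have f0E y : quad_cone z y ->
    neg_power (p z) 2 y = 1 * y 0 i0 `^ (- 2) * (1 * second_factor z y `^ (- 2)).
  by move=> [y0 yl]; rewrite /neg_power quad_eval !mul1r powRM// ltW.
have [g Pg gE] := neg_powers_alternating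
  (fun x y => (mxE _ _ _ _ : (x + y) 0 i0 = x 0 i0 + y 0 i0))
  (fun t x => (mxE _ _ _ _ : (t *: x) 0 i0 = t * x 0 i0))
  (@second_factorD _ z) (@second_factorZ _ z) oC (fun x Cx => Cx.1) (fun x Cx => Cx.2) P0 f0E Cvs.
rewrite gE//.
rewrite mulrA -exprMn mulrNN mul1r expr1n mul1r.
exact: neg_powers_ge0 Pg.
Qed.
End ExampleMonotone.

(** * Laplace transforms of ramps and iterated integrals *)

Section RampLaplaceTransform.
Variable R : realType.
Implicit Types (s c a : R).

Lemma is_derive_expR_lin s a : is_derive a 1 (fun a => expR (- (s * a))) (- s * expR (- (s * a))).
Proof.
have d1 : is_derive a 1 (fun a : R => - (s * a)) (- s).
  have -> : (fun a : R => - (s * a)) = (- s) \*: id.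
    by apply/funext => x /=; rewrite /GRing.scale/= mulNr.
  by apply: is_derive_eq; exact: mulr1.
have := @is_derive1_comp R expR (fun a => - (s * a)) a _ _ (is_derive_expR _) d1.
by rewrite mulrC.
Qed.

Definition ramp_antiderivative s c a : R := - ((a - c) / s + s ^- 2) * expR (- (s * a)).

Lemma is_derive_ramp s c a : s != 0 ->
  is_derive a 1 (ramp_antiderivative s c) ((a - c) * expR (- (s * a))).
Proof.
move=> s0; have de := is_derive_expR_lin s a.
have du : is_derive a 1 (fun a : R => - ((a - c) / s + s ^- 2)) (- s^-1).
  have d0 : is_derive a 1 (fun a : R => a - c) 1.
    by have := is_deriveB (is_derive_id a (1 : R)) (is_derive_cst c a 1); rewrite subr0.
  have d1 : is_derive a 1 (fun a : R => (a - c) / s) s^-1.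
    have -> : (fun a : R => (a - c) / s) = s^-1 \*: (fun a : R => a - c).
      by apply/funext => x /=; rewrite mulrC.
    by apply: is_derive_eq (is_deriveZ s^-1 d0) _; exact: mulr1.
  have := is_deriveN (is_deriveD d1 (is_derive_cst (s ^- 2) a 1)).
  by rewrite addr0.
apply: is_derive_eq (is_deriveM du de) _.
rewrite /GRing.scale/=; by field.
Qed.

(** Squaring the bound 1 + a / 2 <= exp (a / 2). *)
Lemma expR_lower a : 0 <= a -> a ^+ 2 / 4 <= expR a.
Proof.
move=> a0; have -> : expR a = expR (a / 2) ^+ 2.
  by rewrite expr2 -expRD -splitr.
have h := expR_ge1Dx (a / 2).
have h2 : a / 2 <= expR (a / 2) by rewrite (le_trans _ h)// lerDr.
have -> : a ^+ 2 / 4 = (a / 2) ^+ 2 by field.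
by rewrite lerXn2r ?nnegrE ?expR_ge0 ?divr_ge0.
Qed.

Lemma ramp_antiderivative_cvg s c : 0 < s ->
  ramp_antiderivative s c a @[a --> +oo] --> (0 : R).
Proof.
move=> s0; apply/cvgrPdist_lt => eps eps0; near=> a.
have a0 : 0 < a by near: a; apply: nbhs_pinfty_gt; exact: num_real.
have ac : `|c| < a by near: a; apply: nbhs_pinfty_gt; exact: num_real.
have as1 : s^-1 < a by near: a; apply: nbhs_pinfty_gt; exact: num_real.
have ae : 12 / (s ^+ 3 * eps) < a by near: a; apply: nbhs_pinfty_gt; exact: num_real.
rewrite sub0r normrN /ramp_antiderivative normrM normrN [`|expR _|]ger0_norm ?expR_ge0//.
have si : 0 < s^-1 by rewrite invr_gt0.
have h1 : `|(a - c) / s + s ^- 2| <= 3 * a / s.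
  apply: le_trans (ler_normD _ _) _.
  rewrite normrM (ger0_norm (ltW si)) [`|s ^- 2|]ger0_norm; last by rewrite invr_ge0 exprn_ge0// ltW.
  have : `|a - c| <= 2 * a.
    by apply: le_trans (ler_normB _ _) _; rewrite (gtr0_norm a0); lra.
  have -> : s ^- 2 = s^-1 * s^-1 by rewrite expr2 invfM.
  nra.
have sa0 : 0 < s * a by rewrite mulr_gt0.
have h2 : expR (- (s * a)) <= 4 / (s * a) ^+ 2.
  rewrite expRN -[4 / _]invrK lef_pV2 ?posrE ?expR_gt0 ?invr_gt0 ?divr_gt0 ?exprn_gt0//.
  by rewrite invf_div expR_lower// ltW.
apply: le_lt_trans (ler_pM _ _ h1 h2) _; rewrite ?normr_ge0 ?expR_ge0//.
have -> : 3 * a / s * (4 / (s * a) ^+ 2) = (12 / (s ^+ 3 * eps)) * eps / a.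
  by field; rewrite !gt_eqF.
by rewrite ltr_pdivrMr// mulrC ltr_pM2l.
Unshelve. all: by end_near. Qed.

(** The integrand has an antiderivative that tends to 0 at infinity. *)
Lemma laplace_ramp s c : 0 < s ->
  (\int[@lebesgue_measure R]_a (Num.max 0 (a - c) * expR (- (s * a)))%:E =
   (expR (- (s * c)) / s ^+ 2)%:E)%E.
Proof.
move=> s0.
have E : (fun a : R => (Num.max 0 (a - c) * expR (- (s * a)))%:E) =
    (fun a => ((a - c) * expR (- (s * a)))%:E) \_ `[c, +oo[.
  apply/funext => a; rewrite patchE; case: ifPn; rewrite ?inE ?notin_setE/= in_itv/= andbT => ca.
    by rewrite max_r// subr_ge0.
  by rewrite max_l ?mul0r// subr_le0 leNgt; apply/negP => /ltW.
rewrite [LHS](_ : _ = \int[@lebesgue_measure R]_(a in `[c, +oo[) ((a - c) * expR (- (s * a)))%:E)%E; last first.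
  by rewrite [RHS]integral_mkcond -E.
have d a : is_derive a 1 (ramp_antiderivative s c) ((a - c) * expR (- (s * a))).
  by apply: is_derive_ramp; rewrite gt_eqF.
have cF : continuous (ramp_antiderivative s c).
  by move=> a; apply/differentiable_continuous/derivable1_diffP; have [] := d a.
have cf : continuous (fun a : R => (a - c) * expR (- (s * a))).
  move=> a; have c1 : {for a, continuous (fun a : R => a - c)}.
    by apply: continuousB; [exact: cvg_id | exact: cst_continuous].
  have c2 : {for a, continuous (fun a => expR (- (s * a)))}.
    by apply/differentiable_continuous/derivable1_diffP; have [] := is_derive_expR_lin s a.
  exact: continuousM c1 c2.
rewrite (@ge0_continuous_FTC2y _ _ (ramp_antiderivative s c) c 0).
- rewrite -[LHS]/((0 - ramp_antiderivative s c c)%:E).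
  by rewrite /ramp_antiderivative subrr mul0r !add0r mulNr opprK mulrC.
- by move=> a ca; rewrite mulr_ge0 ?expR_ge0 ?subr_ge0.
- exact: continuous_subspaceT.
- exact: ramp_antiderivative_cvg.
- by move=> a _; have [] := d a.
- by apply: cvg_at_right_filter; exact: cF.
- by move=> a _; rewrite derive1E; have da := d a; rewrite derive_val.
Qed.
End RampLaplaceTransform.

Section TonelliTuples.
Variable R : realType.
Notation leb := (@lebesgue_measure R).
Notation T n := (n.-tuple (measurableTypeR R)).
Local Open Scope ereal_scope.

Lemma integral_lebesgue_tupleS n (F : T n.+1 -> \bar R) : measurable_fun setT F ->
  (forall t, 0 <= F t) ->
  \int[@lebesgue_tuple R n.+1]_t F t =
  \int[@lebesgue_tuple R n]_t \int[leb]_a F [tuple of a :: t].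
Proof.
move=> mF F0.
have mFc : measurable_fun setT (F \o @cons_pair R n).
  by apply: measurableT_comp => //; exact: measurable_cons_pair.
transitivity (\int[(leb \x @lebesgue_tuple R n)%E]_w (F \o @cons_pair R n) w).
  have := @ge0_integral_pushforward _ _ _ _ R (@cons_pair R n) (@measurable_cons_pair R n)
    (leb \x @lebesgue_tuple R n)%E setT F measurableT mF (fun t _ => F0 t).
  by rewrite preimage_setT; exact.
rewrite fubini_tonelli2//.
by move=> w; exact: F0.
Qed.

Lemma integral_lebesgue_tuple2 (F : T 2 -> \bar R) : measurable_fun setT F ->
  (forall t, 0 <= F t) ->
  \int[@lebesgue_tuple R 2]_t F t = \int[leb]_b \int[leb]_a F [tuple a; b].
Proof.
move=> mF F0; rewrite integral_lebesgue_tupleS//.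
pose G (t : T 1) := \int[leb]_a F [tuple of a :: t].
have mFc : measurable_fun setT (F \o @cons_pair R 1).
  by apply: measurableT_comp => //; exact: measurable_cons_pair.
have mG : measurable_fun setT G.
  exact: (@measurable_fun_fubini_tonelli_G _ _ _ _ R leb (F \o @cons_pair R 1) mFc (fun w => F0 _)).
have G0 t : 0 <= G t by apply: integral_ge0 => a _; exact: F0.
rewrite -/G integral_lebesgue_tupleS// /=.
have mGc : measurable_fun setT (G \o @cons_pair R 0).
  by apply: measurableT_comp => //; exact: measurable_cons_pair.
rewrite integral_dirac//; last first.
  exact: (@measurable_fun_fubini_tonelli_G _ _ _ _ R leb (G \o @cons_pair R 0) mGc (fun w => G0 _)).
rewrite diracT mul1e.
by apply: eq_integral => b _; apply: eq_integral => a _; congr F; exact: val_inj.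
Qed.
End TonelliTuples.

(** * The kernel of the family and the failure of homogeneity *)

Section ExampleKernel.
Variable R : realType.
Notation i0 := (ord0 : 'I_2).
Notation i1 := (lift ord0 ord0 : 'I_2).
Implicit Types (z x y : 'rV[R]_2).
Notation A := quad_exps.
Notation e := (quad_e R).
Notation p z := (poly_of_coefs A z).
Notation leb := (@lebesgue_measure R).

(** With the determinant z_2 of the two linear factors x_1 and z_1 x_1 + z_2 x_2,
    the coordinates of [y] in the basis of these factors are [quad_minor z y]
    and y_2, divided by z_2. *)
Definition quad_minor z y : R := z 0 i1 * y 0 i0 - z 0 i0 * y 0 i1.

(** The product of the two coordinates of [y] on the linear factors, truncated at
    0, is the kernel of the product of inverse squares; the third power of z_2
    collects the two denominators and the Jacobian determinant. *)
Definition quad_kernel z y : R :=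
  Num.max 0 (y 0 i1) * Num.max 0 (quad_minor z y) / z 0 i1 ^+ 3.

Lemma dotrow_quad z y x : z 0 i1 != 0 ->
  dotrow y x = (x 0 i0 * quad_minor z y + y 0 i1 * second_factor z x) / z 0 i1.
Proof.
by move=> z1; rewrite /dotrow big_ord_recl big_ord1 /quad_minor /second_factor; field.
Qed.

Lemma quad_kernel_pos z y : 0 < y 0 i1 -> 0 < quad_minor z y ->
  quad_kernel z y = y 0 i1 * quad_minor z y * (z 0 i1)^-1 ^+ 3.
Proof. by move=> y1 w0; rewrite /quad_kernel !max_r ?ltW// exprVn. Qed.

Lemma quad_kernel_ge0 z y : quad_U z -> 0 <= quad_kernel z y.
Proof.
move=> [_ z1]; rewrite /quad_kernel divr_ge0 ?exprn_ge0 ?(ltW z1)//.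
by rewrite mulr_ge0// le_max lexx.
Qed.

Lemma quad_kernel_support z y : quad_U z -> ~ dual_cone (quad_cone z) y -> quad_kernel z y = 0.
Proof.
move=> [_ z1] ny; rewrite /quad_kernel.
have [y1|y1] := lerP (y 0 i1) 0; first by rewrite !mul0r.
have [w0|w0] := lerP (quad_minor z y) 0; first by rewrite mulr0 mul0r.
exfalso; apply: ny => x [x0 xl]; rewrite (dotrow_quad _ _ (lt0r_neq0 z1)).
by rewrite divr_ge0 ?addr_ge0 ?mulr_ge0 ?ltW.
Qed.

Lemma measurable_quad_kernel z :
  measurable_fun setT (fun t : 2.-tuple (measurableTypeR R) => quad_kernel z (row_of_tuple t)).
Proof.
have mc (i : 'I_2) : measurable_fun setT
    (fun t : 2.-tuple (measurableTypeR R) => (row_of_tuple t : 'rV[R]_2) 0 i).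
  by under eq_fun do rewrite mxE; exact: measurable_tnth.
have mm (f : 2.-tuple (measurableTypeR R) -> R) : measurable_fun setT f ->
    measurable_fun setT (fun t : 2.-tuple (measurableTypeR R) => Num.max 0 (f t) : R).
  by move=> mf; apply: measurable_maxr => //; exact: measurable_cst.
apply: measurable_funM; last exact: measurable_cst.
apply: measurable_funM; apply: mm; first exact: mc.
by apply: measurable_funB; apply: measurable_funM => //; exact: measurable_cst.
Qed.

(** For a fixed second coordinate of [y] both the inner and then the outer
    integral are Laplace transforms of ramps. *)
Lemma quad_kernel_laplace z x : quad_U z -> quad_cone z x ->
  (\int[@lebesgue_tuple R 2]_t
     (expR (- dotrow (row_of_tuple t) x) * quad_kernel z (row_of_tuple t))%:E =
   ((x 0 i0 * second_factor z x) ^- 2)%:E)%E.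
Proof.
move=> Uz [x0 xl]; have [z0 z1] := Uz.
rewrite integral_lebesgue_tuple2; last 2 first.
- apply/measurable_EFinP/measurable_funM; last exact: measurable_quad_kernel.
  exact: measurable_exp_dotrow.
- by move=> t; rewrite lee_fin mulr_ge0 ?expR_ge0 ?quad_kernel_ge0.
have mramp s c : measurable_fun setT (fun a : R => (Num.max 0 (a - c) * expR (- (s * a)))%:E).
  apply/measurable_EFinP/measurable_funM.
    apply: measurable_maxr; first exact: measurable_cst.
    by apply: measurable_funB => //; exact: measurable_cst.
  by apply: measurableT_comp => //; exact: measurableT_comp.
have ramp0 s c a : (0 <= (Num.max 0 (a - c) * expR (- (s * a)))%:E)%E.
  by rewrite lee_fin mulr_ge0 ?expR_ge0// le_max lexx.
pose s := second_factor z x / z 0 i1.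
have s0 : 0 < s by rewrite divr_gt0.
have inner (b : R) : (\int[leb]_a (expR (- dotrow (row_of_tuple [tuple a; b]) x) *
      quad_kernel z (row_of_tuple [tuple a; b]))%:E =
    ((z 0 i1 * x 0 i0) ^- 2)%:E * (Num.max 0 (b - 0) * expR (- (s * b)))%:E)%E.
  pose c := z 0 i0 * b / z 0 i1.
  pose k := Num.max 0 b * expR (- (b * x 0 i1)) / z 0 i1 ^+ 2.
  have k0 : 0 <= k by rewrite !mulr_ge0 ?expR_ge0 ?invr_ge0 ?exprn_ge0 ?(ltW z1)// le_max lexx.
  transitivity (\int[leb]_a (k%:E * (Num.max 0 (a - c) * expR (- (x 0 i0 * a)))%:E))%E.
    apply: eq_integral => a _; rewrite -EFinM; congr (_%:E).
    have r0 : (row_of_tuple [tuple a; b] : 'rV[R]_2) 0 i0 = a by rewrite mxE.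
    have r1 : (row_of_tuple [tuple a; b] : 'rV[R]_2) 0 i1 = b by rewrite mxE.
    rewrite /dotrow big_ord_recl big_ord1 /quad_kernel /quad_minor r0 r1.
    have -> : z 0 i1 * a - z 0 i0 * b = z 0 i1 * (a - c).
      by rewrite /c; field; rewrite gt_eqF.
    have -> : Num.max 0 (z 0 i1 * (a - c)) = z 0 i1 * Num.max 0 (a - c).
      by rewrite maxr_pMr ?(ltW z1)// mulr0.
    rewrite opprD expRD /k [a * _]mulrC.
    by field; rewrite gt_eqF.
  rewrite ge0_integralZl ?lee_fin//; last exact: mramp.
  rewrite [X in (_ * X)%E](laplace_ramp _ x0) -!EFinM; congr (_%:E).
  rewrite /k subr0; have -> : expR (- (s * b)) = expR (- (b * x 0 i1)) * expR (- (x 0 i0 * c)).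
    by rewrite -expRD /s /c /second_factor; congr expR; field; rewrite gt_eqF.
  by field; rewrite !gt_eqF.
under eq_integral do rewrite inner.
have K0 : (0 <= ((z 0 i1 * x 0 i0) ^- 2)%:E)%E.
  by rewrite lee_fin invr_ge0 exprn_ge0// mulr_ge0// ltW.
rewrite ge0_integralZl//; last exact: mramp.
rewrite [X in (_ * X)%E](laplace_ramp _ s0) -EFinM; congr (_%:E).
rewrite mulr0 oppr0 expR0 /s; field.
by rewrite !gt_eqF.
Qed.

Lemma quad_riesz_kernel z : quad_U z ->
  is_riesz_kernel (p z) 2 (quad_cone z) (quad_kernel z).
Proof.
move=> Uz; split.
- by move=> y; exact: quad_kernel_ge0.
- by move=> y; exact: quad_kernel_support.
- exists (fun t => quad_kernel z (row_of_tuple t)); first exact: measurable_quad_kernel.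
  exact: aeW.
move=> x Cx; rewrite quad_neg_power// -quad_kernel_laplace// /lebesgue_int.
rewrite [LHS]integral_mkcond; congr integral; apply/funext => t.
rewrite patchE; case: ifPn => //; rewrite notin_setE => /= tC.
by rewrite quad_kernel_support// mulr0.
Qed.

Lemma open_quad_U : open (@quad_U R).
Proof.
apply: openI.
- apply: (@open_comp _ _ (fun x : 'rV[R]_2 => x 0 i0) [set t | 0 < t]); last exact: open_gt.
  by move=> x _; exact: continuous_coord.
- apply: (@open_comp _ _ (fun x : 'rV[R]_2 => x 0 i1) [set t | 0 < t]); last exact: open_gt.
  by move=> x _; exact: continuous_coord.
Qed.

Lemma quad_riesz_family : riesz_family A 2 2 e (@quad_U R) quad_kernel.
Proof.
split => //; first split => //.
- move=> a; rewrite !inE => /orP[/eqP->|/eqP->];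
    by apply: etrans (mdegE _) _; rewrite !big_ord_recl big_ord0.
- exact: open_quad_U.
move=> z Uz /=; rewrite quad_hyperbolicity_cone//; split.
- exact: quad_hyperbolic.
- exact: quad_completely_monotone.
- exact: quad_riesz_kernel.
Qed.

Definition quad_W : set ('rV[R]_2 * 'rV[R]_2) :=
  [set w : 'rV[R]_2 * 'rV[R]_2 | quad_U w.1 /\ (0 < w.2 0 i1 /\ 0 < quad_minor w.1 w.2)].

Lemma continuous_fst_coord (i : 'I_2) :
  continuous (fun w : 'rV[R]_2 * 'rV[R]_2 => w.1 0 i).
Proof.
move=> w; apply: (@continuous_comp _ _ _ fst (fun z : 'rV[R]_2 => z 0 i)); first exact: cvg_fst.
exact: continuous_coord.
Qed.

Lemma continuous_snd_coord (i : 'I_2) :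
  continuous (fun w : 'rV[R]_2 * 'rV[R]_2 => w.2 0 i).
Proof.
move=> w; apply: (@continuous_comp _ _ _ snd (fun z : 'rV[R]_2 => z 0 i)); first exact: cvg_snd.
exact: continuous_coord.
Qed.

Lemma continuous_quad_minor :
  continuous (fun w : 'rV[R]_2 * 'rV[R]_2 => quad_minor w.1 w.2).
Proof.
move=> w.
exact: (continuousB (continuousM (@continuous_fst_coord i1 w) (@continuous_snd_coord i0 w))
  (continuousM (@continuous_fst_coord i0 w) (@continuous_snd_coord i1 w))).
Qed.

Lemma open_quad_W : open quad_W.
Proof.
have op (f : 'rV[R]_2 * 'rV[R]_2 -> R) : continuous f -> open [set w | 0 < f w].
  by move=> cf; apply: (@open_comp _ _ f [set t | 0 < t]) => [w _|]; [exact: cf|exact: open_gt].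
apply: openI; first apply: openI.
- exact: (op (fun w => w.1 0 i0) (@continuous_fst_coord i0)).
- exact: (op (fun w => w.1 0 i1) (@continuous_fst_coord i1)).
apply: openI.
- exact: (op (fun w => w.2 0 i1) (@continuous_snd_coord i1)).
- exact: (op _ continuous_quad_minor).
Qed.

Lemma quad_kernel_class_C k : class_C k quad_W (fun w => quad_kernel w.1 w.2).
Proof.
have oW := open_quad_W.
have C1 (i : 'I_2) : class_C k quad_W (fun w : 'rV[R]_2 * 'rV[R]_2 => w.1 0 i).
  apply: (class_C_linear oW) => [x y|t x|]; [by rewrite mxE|by rewrite mxE|].
  exact: continuous_fst_coord.
have C2 (i : 'I_2) : class_C k quad_W (fun w : 'rV[R]_2 * 'rV[R]_2 => w.2 0 i).
  apply: (class_C_linear oW) => [x y|t x|]; [by rewrite mxE|by rewrite mxE|].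
  exact: continuous_snd_coord.
have Cm : class_C k quad_W (fun w : 'rV[R]_2 * 'rV[R]_2 =>
    w.1 0 i1 * w.2 0 i0 + -1 * (w.1 0 i0 * w.2 0 i1)).
  apply: (class_CD oW); first exact: (class_CM oW (C1 i1) (C2 i0)).
  exact: (class_CM oW (class_C_cst oW k (-1)) (class_CM oW (C1 i0) (C2 i1))).
have CV := class_CV oW (fun w (Ww : quad_W w) => lt0r_neq0 Ww.1.2) (C1 i1).
apply: (class_C_ext oW _ (class_CM oW (class_CM oW (C2 i1) Cm)
  (class_CM oW CV (class_CM oW CV CV)))) => w [_ [y1 w0]].
by rewrite quad_kernel_pos// /quad_minor mulN1r !exprS expr0 mulr1.
Qed.

Lemma is_derive_quad_kernel z y : quad_W (z, y) ->
  is_derive z (delta_mx 0 i1) (fun z => quad_kernel z y)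
    (y 0 i1 * (z 0 i1 * y 0 i0 - 3 * quad_minor z y) * (z 0 i1)^-1 ^+ 4).
Proof.
move=> [Uz [/= y1 w0]]; have [z0 z1] := Uz.
have dz1 : is_derive z (delta_mx 0 i1) (fun z : 'rV[R]_2 => z 0 i1) 1.
  have := @is_derive_linear _ _ (fun z : 'rV[R]_2 => z 0 i1) (delta_mx 0 i1) z.
  by rewrite !mxE !eqxx /=; apply => [u v|t u]; rewrite mxE.
have dm : is_derive z (delta_mx 0 i1) (quad_minor ^~ y) (y 0 i0).
  have <- : quad_minor (delta_mx 0 i1) y = y 0 i0.
    by rewrite /quad_minor !mxE !eqxx /= mul1r mul0r subr0.
  by apply: is_derive_linear => [u v|t u]; rewrite /quad_minor !mxE; ring.
have dV := is_derive_inv (lt0r_neq0 z1) dz1.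
have dVV := is_deriveM dV (is_deriveM dV dV).
have dall := is_deriveZ (y 0 i1) (is_deriveM dm dVV).
apply: (@near_eq_is_derive _ _ _ _ _ _ _ _ _ (is_derive_eq dall _)).
  have oW : \forall w \near (z, y), quad_W w.
    by apply: open_nbhs_nbhs; split; [exact: open_quad_W | split].
  have [r r0 H] := (near_pairP z y _).1 oW.
  apply/nbhs_ballP; exists r => // z'; rewrite -ball_normE/= => z'z.
  have [_ [y1' w0']] : quad_W (z', y) by apply: H; rewrite ?subrr ?normr0// distrC.
  rewrite quad_kernel_pos// !exprS expr0 mulr1 /GRing.scale/=; exact: mulrA.
rewrite !mulrfctE /GRing.scale/= /quad_minor; field.
by rewrite gt_eqF.
Qed.

(** A homogeneity degree would have to satisfy
    (beta_2 + 3) (z_2 y_1 - z_1 y_2) = z_2 y_1 for all admissible [z]; changing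
    z_1 alone forces beta_2 = -3, and then z_2 y_1 = 0. *)
Lemma quad_kernel_not_homogeneous y : (exists z, quad_W (z, y)) ->
  ~ exists beta : 'rV[R[i]]_2,
      A_homogeneous A beta [set z | quad_W (z, y)] (fun z => quad_kernel z y).
Proof.
move=> [z Wz] [beta H]; have [[z0 z1] [/= y1 w0]] := Wz.
(* Lowering z_1 increases the minor, so this stays in the open set. *)
pose z' : 'rV[R]_2 := \row_i (if i == i0 then z 0 i0 / 2 else z 0 i1).
have z'0 : z' 0 i0 = z 0 i0 / 2 by rewrite mxE.
have z'1 : z' 0 i1 = z 0 i1 by rewrite mxE.
have w'E : quad_minor z' y = quad_minor z y + z 0 i0 * y 0 i1 / 2.
  by rewrite /quad_minor z'0 z'1; field.
have zy : 0 < z 0 i0 * y 0 i1 by rewrite mulr_gt0.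
have Wz' : quad_W (z', y).
  split; first by split; rewrite ?z'0 ?z'1// divr_gt0.
  by split => //=; rewrite w'E addr_gt0// divr_gt0.
have key z2 : quad_W (z2, y) -> (beta 0 i1) * real_complex R (quad_minor z2 y) =
    real_complex R (z2 0 i1 * y 0 i0 - 3 * quad_minor z2 y).
  move=> W2; have [[_ b1] [/= _ w2]] := W2; have := H i1 z2 W2.
  rewrite /euler_operator big_ord_recl big_ord1.
  have -> : (tnth (tnth A ord0) i1)%:R = 0 :> R by [].
  have -> : (tnth (tnth A (lift ord0 ord0)) i1)%:R = 1 :> R by [].
  have d2 := is_derive_quad_kernel W2.
  rewrite !mul0r add0r mul1r (@derive_val _ _ _ _ _ _ _ d2) quad_kernel_pos//.
  pose k := y 0 i1 * (z2 0 i1)^-1 ^+ 3.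
  have k0 : real_complex R k != 0.
    by rewrite (inj_eq (@complexI R)) mulf_neq0 ?expf_neq0 ?invr_neq0 ?gt_eqF.
  have -> : z2 0 i1 * (y 0 i1 * (z2 0 i1 * y 0 i0 - 3 * quad_minor z2 y) * (z2 0 i1)^-1 ^+ 4) =
      (z2 0 i1 * y 0 i0 - 3 * quad_minor z2 y) * k.
    by rewrite /k; field; rewrite gt_eqF.
  have -> : y 0 i1 * quad_minor z2 y * (z2 0 i1)^-1 ^+ 3 = quad_minor z2 y * k.
    by rewrite /k; ring.
  rewrite (rmorphM _ _ k) (rmorphM _ _ k)/= [_ * (_ * k%:C%C)]mulrA -mulrBl => /eqP.
  by rewrite mulf_eq0 (negbTE k0) orbF subr_eq0 => /eqP.
have key3 z2 : quad_W (z2, y) -> (beta 0 i1 + 3) * real_complex R (quad_minor z2 y) =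
    real_complex R (z2 0 i1 * y 0 i0).
  move=> /key E; rewrite mulrDl E rmorphB (rmorphM _ 3) rmorph_nat/=.
  by rewrite subrK.
have E1 := key3 z Wz; have := key3 z' Wz'.
rewrite z'1 w'E rmorphD mulrDr E1 => /eqP; rewrite addrC -subr_eq0 addrK mulf_eq0 => /orP[b3|].
  move: E1; rewrite (eqP b3) mul0r => /esym/eqP; rewrite -(rmorph0 (real_complex R)).
  rewrite (inj_eq (@complexI R)) => /eqP zy0.
  by move: w0; rewrite /quad_minor zy0 sub0r oppr_gt0 ltNge (ltW zy).
by rewrite -(rmorph0 (real_complex R)) (inj_eq (@complexI R)) gt_eqF// divr_gt0.
Qed.
End ExampleKernel.

Theorem proposition7p1 (R : realType) :
  (forall (n m d : nat) (A : m.-tuple (multinom n)) (alpha : R)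
      (e : 'rV[R]_n) (U : set 'rV[R]_m) (q : 'rV[R]_m -> 'rV[R]_n -> R),
    riesz_family A d alpha e U q ->
    forall u v : multinom m, toric_relation A u v ->
    forall W : set ('rV[R]_m * 'rV[R]_n)%type,
      open W -> (forall z y, W (z, y) -> U z) ->
      class_C (maxn (mdeg u) (mdeg v)) W (fun w => q w.1 w.2) ->
    forall z y, W (z, y) -> toric_operator u v (fun z' => q z' y) z = 0)
  /\
  (exists (n m d : nat) (A : m.-tuple (multinom n)) (alpha : R)
      (e : 'rV[R]_n) (U : set 'rV[R]_m) (q : 'rV[R]_m -> 'rV[R]_n -> R),
    riesz_family A d alpha e U q /\
    exists W : set ('rV[R]_m * 'rV[R]_n)%type,
      [/\ open W /\ W !=set0,
          forall z y, W (z, y) -> U z,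
          class_C 1 W (fun w => q w.1 w.2) &
          forall y, (exists z, W (z, y)) ->
            ~ exists beta : 'rV[R[i]]_n,
                A_homogeneous A beta [set z | W (z, y)] (fun z' => q z' y)]).
Proof.
split=> [n m d A alpha e U q fam u v uv W oW WU CW z y Wzy|].
  apply/eqP; rewrite eq_le; apply/andP; split.
    exact: (toric_operator_le0 fam uv oW WU CW Wzy).
  have vu : toric_relation A v u.
    move=> i; apply/eqP; rewrite -oppr_eq0 -sumrN; apply/eqP.
    by apply: etrans (uv i); apply: eq_bigr => j _; rewrite -mulNr opprB.
  rewrite maxnC in CW; have := toric_operator_le0 fam vu oW WU CW Wzy.
  by rewrite /toric_operator !subr_le0 subr_ge0.
exists 2%N, 2%N, 2%N, quad_exps, 2, (quad_e R), (@quad_U R), (@quad_kernel R).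
split; first exact: quad_riesz_family.
exists (@quad_W R); split.
- split; first exact: open_quad_W.
  exists (const_mx 1, \row_i (if i == ord0 then 2 else 1)).
  by rewrite /quad_W /quad_U /quad_minor /= !mxE/= !mul1r; split; [split | split => //; lra].
- by move=> z y [].
- exact: quad_kernel_class_C.
- exact: quad_kernel_not_homogeneous.
Qed.
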